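(* Let $k,n\in\mathbb N$ be such that $k+n\ge2$. Let $a,b\in A_{k,n}$ be such that $l[a]_i=l[b]_i$ for all $i\in\{1,\dots,m[a]\}$. Then for any $f\in C_b^{k+n,(k+n)}(\mathbb R^d\times\mathcal P_2(\mathbb R^d);\mathbb R^e)$, $$\partial_af=\partial_bf$$ in the following sense: for any $e_1,\dots,e_{k+n}\in\mathbb R^d$, any permutation $\sigma$ of $\{1,\dots,k+n\}$ such that $a_{\sigma(i)}=b_i$ for all $i\in\{1,\dots,k+n\}$, and all $x\in\mathbb R^d$, $\mu\in\mathcal P_2(\mathbb R^d)$ and $v_1,\dots,v_m\in\mathbb R^d$ with $m=m[a]=m[b]$, $$\partial_af(x,\mu,v_1,\dots,v_m)\cdot\bigotimes_{i=1}^{k+n}e_i=\partial_bf(x,\mu,v_1,\dots,v_m)\cdot\bigotimes_{i=1}^{k+n}e_{\sigma(i)} .$$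
   Context: $\mathcal P_2(\mathbb R^d)$ is the set of Borel probability measures on $\mathbb R^d$ with finite second moment; $\mathbb W^{(1)}$ is the $1$-Wasserstein distance. $\mathrm{Lin}(U,V)$ is the space of linear maps. Partition sequences: $A_n$ is the set of $a=(a_1,\dots,a_n)$ with $a_1=1$ and $a_k\in\{1,\dots,1+\max_{l<k}a_l\}$ for $k\ge2$ ($A_0$ contains only the empty sequence). $A_{k,n}$ is the set of sequences of length $k+n$ obtained by shuffling $k$ zeros into an element of $A_n$ (exactly $k$ entries are $0$ and the positive entries, read in order, form an element of $A_n$). $A_N^{(0)}=\bigcup_{k=0}^NA_{k,N-k}$. For $a\in A^{(0)}_N$: $m[a]=\max_ia_i$, $l[a]_j=|\{i:a_i=j\}|$. Lions derivative: $g:\mathcal P_2(\mathbb R^d)\to\mathbb R^e$ is Lions differentiable at $\mu$ if $G(X)=g(\mathbb P\circ X^{-1})$ is Fréchet differentiable on $L^2(\Omega,\mathbb P;\mathbb R^d)$ at some $X$ with law $\mu$; then $DG(X)=\partial_\mu g(\mu)(X)$. For $N\in\mathbb N$, $f:\mathbb R^d\times\mathcal P_2(\mathbb R^d)\to\mathbb R^e$ belongs to $C_b^{N,(N)}(\mathbb R^d\times\mathcal P_2(\mathbb R^d);\mathbb R^e)$ if there are functions $\partial_af$, $a\in\bigcup_{i=1}^NA_i^{(0)}$, such that: (1) for $a\in A_i^{(0)}$, $\partial_af:\mathbb R^d\times\mathcal P_2(\mathbb R^d)\times(\mathbb R^d)^{m[a]}\to\mathrm{Lin}((\mathbb R^d)^{\otimes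 i},\mathbb R^e)$, $(x,\mu,v_1,\dots,v_{m[a]})\mapsto\partial_af(x,\mu,v_1,\dots,v_{m[a]})$, with $\partial_{(0)}f=\nabla_xf$ and $\partial_{(1)}f=\partial_\mu f$; (2) all $\partial_af$ are bounded and Lipschitz, $\mathcal P_2(\mathbb R^d)$ being equipped with $\mathbb W^{(1)}$; (3) for $a\in A_i^{(0)}$, $1\le i\le N-1$, $\partial_af$ is differentiable in $x$ with $\partial_x\partial_af=\partial_{(a,0)}f$, in $\mu$ with $\partial_\mu\partial_af=\partial_{(a,m[a]+1)}f$ (new free variable $v_{m[a]+1}$), and in $v_p$, $1\le p\le m[a]$, with $\partial_{v_p}\partial_af=\partial_{(a,p)}f$. In $\partial_{(a_1,\dots,a_N)}f$ the $j$-th tensor slot corresponds to the $j$-th derivative taken. *)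

(* Defs.v *)
From HB Require Import structures.
From mathcomp Require Import all_boot all_order all_algebra all_fingroup.
From mathcomp Require Import all_classical all_reals all_analysis.

Set Implicit Arguments.
Unset Strict Implicit.
Unset Printing Implicit Defensive.

Import Order.TTheory GRing.Theory Num.Theory.
Import numFieldNormedType.Exports.

Local Open Scope classical_set_scope.
Local Open Scope ring_scope.

(* The case i = 0 reads 0 < a_1 <= 1, the maximum over the empty prefix
   being 0; so the first entry is 1. *)
Definition partition_seq (n : nat) (a : seq nat) : bool :=
  (size a == n) &&
  all (fun i => 0 < nth 0 a i <= 1 + \max_(l <- take i a) l)%N (iota 0 (size a)).

Definition shuffle_seq (k n : nat) (a : seq nat) : bool :=
  [&& size a == (k + n)%N, count_mem 0%N a == k &
      partition_seq n [seq c <- a | c != 0%N]].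

Definition shuffle0_seq (N : nat) (a : seq nat) : bool :=
  [exists k : 'I_N.+1, shuffle_seq k (N - k) a].

Definition max_label (a : seq nat) : nat := \max_(c <- a) c.

Section Tensors.
Context {R : realType}.
Implicit Types d i p : nat.

(* The space (R^d)^{(x) i}, in coordinates over its canonical basis
   (e_{phi 0} (x) ... (x) e_{phi (i - 1)}), phi ranging over {ffun 'I_i -> 'I_d}.
   A linear map from it to R^p is a matrix acting on row vectors. *)
Definition tdim d i : nat := #|{ffun 'I_i -> 'I_d}|.

Definition tindex d i (r : 'I_(tdim d i)) : {ffun 'I_i -> 'I_d} := enum_val r.

Definition tens d i (u : 'I_i -> 'rV[R]_d) : 'rV[R]_(tdim d i) :=
  \row_r \prod_(j < i) u j 0 (tindex r j).

Definition snoc_index d i (phi : {ffun 'I_i -> 'I_d}) (c : 'I_d) :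
    {ffun 'I_i.+1 -> 'I_d} :=
  [ffun j => if unlift ord_max j is Some j' then phi j' else c].

(* Currying Lin((R^d)^{(x) i.+1}, R^p) = Lin(R^d, Lin((R^d)^{(x) i}, R^p))
   on the last slot; see tens_plug_last. *)
Definition plug_last d i p (M : 'M[R]_(tdim d i.+1, p)) (h : 'rV[R]_d) :
    'M[R]_(tdim d i, p) :=
  \matrix_(r, q)
    \sum_(c < d) h 0 c * M (enum_rank (snoc_index (tindex r) c)) q.

Lemma tens_plug_last d i p (M : 'M[R]_(tdim d i.+1, p)) (u : 'I_i.+1 -> 'rV[R]_d) :
  tens (u \o lift ord_max) *m plug_last M (u ord_max) = tens u *m M.
Proof.
apply/rowP => q; rewrite !mxE.
rewrite [RHS](reindex (fun rc : 'I_(tdim d i) * 'I_d =>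
    enum_rank (snoc_index (tindex rc.1) rc.2))) /=; last first.
  exists (fun r : 'I_(tdim d i.+1) =>
    (enum_rank [ffun j => tindex r (lift ord_max j)], tindex r ord_max)).
  - case=> r c _ /=; rewrite /tindex enum_rankK; congr pair.
    + apply: enum_val_inj; rewrite enum_rankK; apply/ffunP => j.
      by rewrite !ffunE liftK.
    + by rewrite ffunE unlift_none.
  - move=> r _ /=; apply: enum_val_inj; rewrite !enum_rankK.
    apply/ffunP => j; rewrite !ffunE.
    by case: unliftP => [j' ->|->] //=; rewrite /tindex enum_rankK ffunE.
rewrite -(pair_bigA _ (fun r c =>
  tens u 0 (enum_rank (snoc_index (tindex r) c)) *
  M (enum_rank (snoc_index (tindex r) c)) q)) /=.
apply: eq_bigr => r _; rewrite !mxE mulr_sumr; apply: eq_bigr => c _.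
rewrite mulrA; congr (_ * _); rewrite mxE /tindex enum_rankK big_ord_recr /=.
congr (_ * _); last by rewrite ffunE unlift_none.
apply: eq_bigr => j _.
have -> : widen_ord (leqnSn i) j = lift ord_max j.
  by apply: val_inj; rewrite /= /bump leqNgt ltn_ord.
by rewrite ffunE liftK.
Qed.

End Tensors.

Section Wasserstein.
Variable R : realType.

(* The Euclidean norm; the norm `| _ | of 'rV[R]_d is the maximum norm. *)
Definition enorm d (x : 'rV[R]_d) : R := Num.sqrt (\sum_(i < d) x 0 i ^+ 2).

(* R^d with its Borel sigma-algebra. *)
Definition borel d := g_sigma_algebraType (@open 'rV[R]_d).

(* Measures are functions on all sets, relevant on measurable sets only: two
   elements of P2 denote the same measure when they agree on Borel sets, and
   this, not Leibniz equality, is what has_law uses. *)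
Record P2 d := MkP2 {
  P2_prob :> probability (borel d) R ;
  P2_moment : (\int[P2_prob]_x (enorm x ^+ 2)%:E < +oo)%E
}.

Definition is_coupling d (mu nu : P2 d) (pi : probability (borel d * borel d)%type R) :=
  forall A : set (borel d), measurable A ->
    pi (A `*` setT) = mu A /\ pi (setT `*` A) = nu A.

Definition W1 d (mu nu : P2 d) : \bar R :=
  ereal_inf [set (\int[pi]_z (enorm (z.1 - z.2 : 'rV[R]_d))%:E)%E
            | pi in is_coupling mu nu].

End Wasserstein.

Section Lions.
Context {R : realType} {disp : measure_display} {Om : measurableType disp}.
Variable P : probability Om R.

Definition in_L2 d (X : {RV P >-> borel R d}) : Prop :=
  (\int[P]_w (enorm (X w) ^+ 2)%:E < +oo)%E.

Definition L2dist d (X Y : {RV P >-> borel R d}) : R :=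
  Num.sqrt (\int[P]_w (enorm (Y w - X w : 'rV[R]_d) ^+ 2)).

Definition has_law d (X : {RV P >-> borel R d}) (mu : P2 R d) : Prop :=
  forall A : set (borel R d), measurable A -> P (X @^-1` A) = mu A.

(* g is Lions differentiable at mu and D is the derivative: for some X in L^2
   with law mu, the lift G(Y) = g(law Y) is Frechet differentiable at X, and
   DG(X) is represented by D(X), i.e. DG(X)(H) = E[D(X) H]. Here D maps R^d to
   Lin(R^d, 'M_(p, q)) and belongs to L^2(mu), so that DG(X) is automatically
   a bounded operator. The quantification over all nu with has_law Y nu forces
   g to depend only on the values of measures on Borel sets. *)
Definition is_lions_derivative d p q (g : P2 R d -> 'M[R]_(p, q)) (mu : P2 R d)
    (D : 'rV[R]_d -> 'rV[R]_d -> 'M[R]_(p, q)) : Prop :=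
  [/\ forall v, linear (D v),
      forall h i j, measurable_fun [set: borel R d] (fun v : borel R d => D v h i j) /\
        (\int[mu]_v (D v h i j ^+ 2)%:E < +oo)%E
    & exists X : {RV P >-> borel R d}, [/\ in_L2 X, has_law X mu &
        forall eps : R, 0 < eps -> exists2 delta : R, 0 < delta &
        forall (Y : {RV P >-> borel R d}) (nu : P2 R d),
          in_L2 Y -> has_law Y nu -> L2dist X Y < delta ->
          `| g nu - g mu -
             \matrix_(i, j) (\int[P]_w (D (X w) (Y w - X w) i j)) |
          <= eps * L2dist X Y ] ].

End Lions.

Section Derivatives.
Variables (R : realType) (d e : nat).

(* Candidates for the derivatives (x, mu, (v_1, ..., v_m[a])) |-> d_a f; only
   the values at sequences a satisfying shuffle0_seq matter. *)
Definition deriv_family :=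
  forall (i : nat) (a : i.-tuple nat),
    'rV[R]_d -> P2 R d -> ('I_(max_label a) -> 'rV[R]_d) -> 'M[R]_(tdim d i, e).

(* (v_1, ..., v_m[a]), read off a sequence v with v p standing for v_p
   (v 0 is not used). The derivatives along a and along an extension of a,
   which take different numbers of variables, can thus share the same v. *)
Definition vars (a : seq nat) (v : nat -> 'rV[R]_d) :
  'I_(max_label a) -> 'rV[R]_d := fun j => v j.+1.

End Derivatives.

Arguments vars {R d} a v.

Section Cb.
Context {R : realType} {disp : measure_display} {Om : measurableType disp}.
Variables (P : probability Om R) (d e : nat).

(* f belongs to C_b^{N,(N)}, with derivatives D. Boundedness and the Lipschitz
   property are those of maps into a finite-dimensional space, where the
   entrywise maximum norm `| _ | is equivalent to any other. *)
Definition Cb_derivatives (N : nat) (f : 'rV[R]_d -> P2 R d -> 'rV[R]_e)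
    (D : deriv_family R d e) : Prop :=
  [/\
    (* D (0) is the gradient of f in x, D (1) its Lions derivative *)
    (0 < N)%N -> forall (x : 'rV[R]_d) (mu : P2 R d) (v : nat -> 'rV[R]_d),
      [/\ differentiable (fun y : 'rV[R]_d => f y mu) x,
          forall h : 'rV[R]_d, 'd (fun y : 'rV[R]_d => f y mu) x h =
            tens (fun _ : 'I_1 => h)
              *m D 1%N [tuple 0%N] x mu (vars [tuple 0%N] v)
        & is_lions_derivative P (f x) mu (fun u h =>
            tens (fun _ : 'I_1 => h)
              *m D 1%N [tuple 1%N] x mu
                   (vars [tuple 1%N] [eta v with 1%N |-> u])) ],
    forall i (a : i.-tuple nat), (0 < i <= N)%N -> shuffle0_seq i a ->
      (exists C : R, forall x mu v, `| D i a x mu v | <= C) /\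
      (exists C : R, forall x y mu nu v w,
        ((`| D i a x mu v - D i a y nu w |)%:E <=
         C%:E * ((enorm (x - y) + \sum_j enorm (v j - w j))%:E + W1 mu nu))%E)
  & forall i (a : i.-tuple nat), (0 < i < N)%N -> shuffle0_seq i a ->
      forall (x : 'rV[R]_d) (mu : P2 R d) (v : nat -> 'rV[R]_d),
      [/\ differentiable (fun y : 'rV[R]_d => D i a y mu (vars a v)) x /\
          (forall h : 'rV[R]_d,
            'd (fun y : 'rV[R]_d => D i a y mu (vars a v)) x h =
            plug_last (D i.+1 [tuple of rcons a 0%N] x mu
                         (vars (rcons a 0%N) v)) h),
          is_lions_derivative P (fun nu => D i a x nu (vars a v)) mu (fun u h =>
            plug_last (D i.+1 [tuple of rcons a (max_label a).+1] x mu
                         (vars (rcons a (max_label a).+1)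
                            [eta v with (max_label a).+1 |-> u])) h)
        & forall p : nat, (1 <= p <= max_label a)%N ->
          differentiable (fun y : 'rV[R]_d =>
            D i a x mu (vars a [eta v with p |-> y])) (v p) /\
          (forall h : 'rV[R]_d,
            'd (fun y : 'rV[R]_d =>
              D i a x mu (vars a [eta v with p |-> y])) (v p) h =
            plug_last (D i.+1 [tuple of rcons a p] x mu
                         (vars (rcons a p) v)) h) ] ].

End Cb.

(* Main.v *)
Require Import Defs.
From HB Require Import structures.
From mathcomp Require Import all_boot all_order all_algebra all_fingroup.
From mathcomp Require Import all_classical all_reals all_analysis.
From mathcomp Require Import measurable_realfun zify ring lra.

Set Implicit Arguments.
Unset Strict Implicit.
Unset Printing Implicit Defensive.

Import Order.TTheory GRing.Theory Num.Theory.
Import numFieldNormedType.Exports.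

Local Open Scope ring_scope.

(** A derivative of [f] is indexed by a word of labels: 0 stands for a
    derivative in [x], a label already used for a derivative in that particle
    variable, and the first unused label for a Lions derivative, which creates
    the corresponding variable. Pairing each label with the vector put in its
    tensor slot turns the claim into: the multilinear value read off a word of
    pairs depends on the multiset of pairs only. Two admissible words with the
    same pairs are connected by admissible words, each obtained from the
    previous one by exchanging two neighbouring pairs ([perm_rel]). It therefore
    suffices to exchange the last two derivatives ([derivative_swap]), and to
    see that an identity between derivatives can be differentiated
    ([derivative_rcons]).

    Both are reduced to functions of finitely many vectors by giving the law an
    atom that can be moved. Let [perturb mu v0 r t z] carry an atom of mass [t]
    at a point [z] of the ball of radius [r] about [v0], the remaining mass
    [1 - t] being distributed as [mu], except that the part of [mu] inside the
    ball is moved to a point outside. If [X] has this law, moving its value on the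
    event [X = z], of probability exactly [t], is an admissible variation in the
    definition of the Lions derivative, whatever [X] and the probability space
    are; hence [z |-> g (perturb mu v0 r t z)] is differentiable with derivative
    [t] times the Lions derivative of [g] at the atom
    ([lions_derivative_move_atom]). When [r] and [t] tend to 0 the perturbed
    laws converge to [mu] for the 1-Wasserstein distance ([W1_perturb_base]), so
    that, the derivatives being Lipschitz, identities pass from perturbed laws
    to [mu] ([eq_of_perturb]).

    For a perturbed law, exchanging two derivatives is the classical theorem of
    Schwarz: a second difference is estimated by the mean value theorem in the
    two possible orders. A derivative in the measure becomes a derivative in the
    atom, at the price of a factor [t]. One case is not classical: a Lions
    derivative followed by a derivative in its own new variable. There the
    second difference involves the motion of the atom in the measure and in the
    variable, but the former contributes [t] times less than the latter
    ([atom_value_increment]), so that the two orders agree up to [O(t)]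
    ([atom_value_swap]), and the error disappears as [t] tends to 0. *)

(** * Reordering words *)

Section words.
Implicit Types a b : seq nat.

(** Zeros may stay in place, since they do not affect the maximum of a prefix:
    a word satisfies this condition exactly when its nonzero entries form a
    partition sequence ([wf_wordE]). *)
Definition wf_word a : bool :=
  all (fun i => nth 0 a i <= (max_label (take i a)).+1)%N (iota 0 (size a)).

Lemma max_label_rcons a c : max_label (rcons a c) = maxn (max_label a) c.
Proof. by rewrite /max_label -cats1 big_cat big_seq1. Qed.

Lemma all_prefix_rcons (Q : nat -> seq nat -> bool) a c :
  all (fun i => Q (nth 0%N (rcons a c) i) (take i (rcons a c))) (iota 0 (size (rcons a c)))
  = all (fun i => Q (nth 0%N a i) (take i a)) (iota 0 (size a)) && Q c a.
Proof.
rewrite size_rcons -addn1 iotaD all_cat /= andbT add0n; congr andb; last first.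
  by rewrite nth_rcons ltnn eqxx -cats1 take_size_cat.
apply: eq_in_all => i; rewrite mem_iota /= add0n => ia.
by rewrite nth_rcons ia -cats1 takel_cat // ltnW.
Qed.

Lemma wf_word_rcons a c : wf_word (rcons a c) = wf_word a && (c <= (max_label a).+1)%N.
Proof. exact: (all_prefix_rcons (fun c a => c <= (max_label a).+1)%N). Qed.

Lemma max_label_filter a : max_label [seq c <- a | c != 0%N] = max_label a.
Proof.
elim/last_ind: a => // a c IH; rewrite filter_rcons max_label_rcons -IH.
by case: eqP => [->|_] /=; rewrite ?maxn0// max_label_rcons.
Qed.

Lemma wf_wordE a n : size [seq c <- a | c != 0%N] = n ->
  wf_word a = partition_seq n [seq c <- a | c != 0%N].
Proof.
move=> <-; rewrite /partition_seq eqxx /= => {n}.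
elim/last_ind: a => // a c IH; rewrite wf_word_rcons filter_rcons.
case: eqP => [->|/eqP c0] /=; first by rewrite andbT.
rewrite (all_prefix_rcons (fun c a => 0 < c <= 1 + \max_(l <- a) l)%N) -IH.
by rewrite lt0n c0 /= -/(max_label _) max_label_filter add1n.
Qed.

Lemma shuffle_seq_wf k n a : shuffle_seq k n a -> wf_word a.
Proof.
by move=> /and3P[_ _ pa]; rewrite (@wf_wordE _ n)//; case/andP: pa => /eqP.
Qed.

Lemma wf_shuffle0_seq a : wf_word a -> shuffle0_seq (size a) a.
Proof.
move=> wa; have ka : (count_mem 0%N a < (size a).+1)%N by rewrite ltnS count_size.
apply/existsP; exists (Ordinal ka); rewrite /shuffle_seq /= eqxx subnKC ?count_size//.
rewrite eqxx /= -wf_wordE// size_filter.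
by rewrite -(count_predC (pred1 0%N) a) addKn.
Qed.

(** The labels of a word have no gap, as each new one exceeds the previous
    maximum by one. *)
Lemma wf_word_max_occurs a m : wf_word a -> (0 < m <= max_label a)%N -> m \in a.
Proof.
elim/last_ind: a => [|a c IH]; first by rewrite /max_label big_nil; case: m.
rewrite wf_word_rcons max_label_rcons mem_rcons inE => /andP[wa cM] /andP[m0].
rewrite leq_max => /orP[mM|mc]; first by rewrite IH ?orbT// m0.
have [//|/= mc'] := eqVneq m c; apply: IH => //; rewrite m0 /=.
by rewrite -ltnS (leq_trans _ cM)// ltn_neqAle mc'.
Qed.

Lemma max_label_perm a b : perm_eq a b -> max_label a = max_label b.
Proof. exact: perm_big. Qed.

Lemma le_max_label a c : c \in a -> (c <= max_label a)%N.
Proof. by move=> ca; rewrite /max_label (big_rem c)//= leq_maxl. Qed.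

End words.

Section reorder.
(* In the application [rel] is equality of the derivatives along two words. *)
Variables (T : eqType) (lab : T -> nat) (rel : seq T -> seq T -> Prop).
Implicit Types (s w : seq T) (p q : T).

Let top s := max_label (map lab s).
Let wf s := wf_word (map lab s).

Hypothesis rel_refl : forall s, rel s s.
Hypothesis rel_trans : forall s1 s2 s3, rel s1 s2 -> rel s2 s3 -> rel s1 s3.
Hypothesis rel_swap : forall w p q, wf w -> (lab p <= (top w).+1)%N ->
  (lab q <= (top w).+1)%N -> rel (rcons (rcons w p) q) (rcons (rcons w q) p).
Hypothesis rel_rcons : forall s1 s2 p, wf s1 -> wf s2 -> perm_eq s1 s2 ->
  rel s1 s2 -> wf (rcons s1 p) -> rel (rcons s1 p) (rcons s2 p).

(** The cases in which deleting [q] leaves no gap among the labels. *)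
Definition removable q s :=
  [|| lab q == 0%N, (1 < count_mem (lab q) (map lab s))%N | (top s <= lab q)%N].

Let wf_rcons s p : wf (rcons s p) = wf s && (lab p <= (top s).+1)%N.
Proof. by rewrite /wf map_rcons wf_word_rcons. Qed.

Let top_rcons s p : top (rcons s p) = maxn (top s) (lab p).
Proof. by rewrite /top map_rcons max_label_rcons. Qed.

Let top_perm s1 s2 : perm_eq s1 s2 -> top s1 = top s2.
Proof. by move=> st; apply: max_label_perm; exact: perm_map. Qed.

Let lab_top p s : p \in s -> (lab p <= top s)%N.
Proof. by move=> ps; apply: le_max_label; exact: map_f. Qed.

Let count_rcons c s p : count_mem c (map lab (rcons s p)) =
  (count_mem c (map lab s) + (lab p == c))%N.
Proof. by rewrite map_rcons -cats1 count_cat /= addn0. Qed.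

Let count_perm c s1 s2 : perm_eq s1 s2 ->
  count_mem c (map lab s1) = count_mem c (map lab s2).
Proof. by move/(perm_map lab)/seq.permP. Qed.

Let perm_swap w p q : perm_eq (rcons (rcons w p) q) (rcons (rcons w q) p).
Proof. by rewrite -!cats1 -!catA perm_cat2l /= -cat1s perm_catC. Qed.

Let perm_rcons2 s1 s2 p : perm_eq (rcons s1 p) (rcons s2 p) = perm_eq s1 s2.
Proof. by rewrite -!cats1 perm_cat2r. Qed.

(** By induction, [q] can be brought to the end of all but the last entry [p],
    and then exchanged with [p]. This breaks down when [q] is the only carrier
    of its label before [p], so that it cannot be moved across the labels that
    appear after it; as [q] is removable, [p] then has the same label, and it is
    first moved one step to the left. *)
Lemma move_to_end q s : wf s -> q \in s -> removable q s ->
  exists s', [/\ wf (rcons s' q), perm_eq s (rcons s' q) & rel s (rcons s' q)].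
Proof.
have [n] := ubnP (size s); elim: n s => // n IH s; case/lastP: s => // s p.
rewrite size_rcons ltnS => sn wfsp; have := wfsp; rewrite wf_rcons => /andP[wfs ps].
rewrite mem_rcons inE; have [-> _ _|qp /= qs rsp] := eqVneq q p; first by exists s.
have [rs|] := boolP (removable q s).
  have [s' [wfq sq Rq]] := IH s sn wfs qs rs.
  have := wfq; rewrite wf_rcons => /andP[wfs' qs'].
  have tops := top_perm sq; rewrite top_rcons in tops.
  have ps' : (lab p <= (top s').+1)%N.
    rewrite leqNgt; apply/negP => pbig.
    (* otherwise [q] introduces a label and [p] the next one, and [q] is not
       removable *)
    have qE : lab q = (top s').+1 by lia.
    have q's : count_mem (lab q) (map lab s') = 0%N.
      apply/count_memPn/negP => /le_max_label; rewrite -/(top s'); lia.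
    have := rsp; rewrite /removable top_rcons count_rcons.
    rewrite (count_perm _ sq) count_rcons q's eqxx; lia.
  exists (rcons s' p); split.
  - by rewrite !wf_rcons wfs' ps' top_rcons /=; move: qs'; clear; lia.
  - by apply: perm_trans (perm_swap _ _ _); rewrite perm_rcons2.
  - apply: rel_trans _ (rel_swap wfs' qs' ps').
    exact: (rel_rcons wfs wfq sq Rq).
rewrite /removable !negb_or -lt0n -leqNgt -ltnNge => /and3P[q0 cq tq].
have cpq : lab p = lab q.
  move: rsp; rewrite /removable top_rcons count_rcons.
  case: (eqVneq (lab p) (lab q)) => // _; rewrite addn0 ltnNge cq /=.
  by move=> /orP[/eqP|]; lia.
case/lastP: s => // s r in sn wfs ps qs rsp wfsp cq tq *.
have := wfs; rewrite wf_rcons => /andP[wfs1 rs1].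
have rq : r != q.
  apply/eqP => rq; subst r; move: cq tq; rewrite top_rcons count_rcons eqxx => cq tq.
  have /count_memPn : count_mem (lab q) (map lab s) = 0%N by lia.
  by rewrite (wf_word_max_occurs wfs1)//; move: q0 tq; rewrite -/(top s); clear; lia.
have qs1 : q \in s by move: qs; rewrite mem_rcons inE eq_sym (negPf rq).
have qtop := lab_top qs1.
have wfp : wf (rcons s p) by rewrite wf_rcons wfs1 cpq ltnW.
have cs : (0 < count_mem (lab q) (map lab s))%N by rewrite -has_count has_pred1 map_f.
have [||||y [wfy sy Ry]] := IH (rcons s p) => //.
- by move: sn; rewrite !size_rcons.
- by rewrite mem_rcons inE qs1 orbT.
- by rewrite /removable count_rcons cpq eqxx addn1 ltnS cs orbT.
have := wfy; rewrite wf_rcons => /andP[wfy1 qy].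
have py : p \in y.
  have : p \in rcons y q by rewrite -(perm_mem sy) mem_rcons mem_head.
  by rewrite mem_rcons inE eq_sym (negPf qp).
have := lab_top py; have := top_perm sy; rewrite !top_rcons => topsy ptop.
have ry : (lab r <= (top y).+1)%N by move: rs1 topsy ptop cpq qtop; clear; lia.
have ps1 : (lab p <= (top s).+1)%N by move: qtop cpq; clear; lia.
exists (rcons y r); split.
- by rewrite !wf_rcons wfy1 ry top_rcons /=; move: qy; clear; lia.
- apply: perm_trans (perm_swap _ _ _) _; apply: perm_trans (perm_swap _ _ _).
  by rewrite perm_rcons2.
- apply: rel_trans (rel_swap wfs1 rs1 ps1) _.
  apply: rel_trans _ (rel_swap wfy1 qy ry).
  apply: (rel_rcons wfp wfy sy Ry).
  by rewrite wf_rcons wfp top_rcons; apply: (leq_trans rs1); rewrite ltnS leq_maxl.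
Qed.

(** All admissible words with the same entries are related: the last entry of
    one of them is moved to the end of the other, and the rest is treated by
    induction. *)
Theorem perm_rel s1 s2 : wf s1 -> wf s2 -> perm_eq s1 s2 -> rel s1 s2.
Proof.
elim/last_ind: s2 s1 => [|s2 q IH] s1 wf1 wf2 s12.
  by move/perm_nilP: s12 => ->.
have := wf2; rewrite wf_rcons => /andP[wfs2 qs2].
have [||s' [wfs' s1' R1]] := @move_to_end q s1 wf1.
- by rewrite (perm_mem s12) mem_rcons mem_head.
- rewrite /removable (count_perm _ s12) count_rcons eqxx (top_perm s12) top_rcons.
  rewrite -[X in X || _]negbK -lt0n; case: ltnP => //= q0; rewrite orbC -implyNb -ltnNge.
  apply/implyP => qtop; rewrite addn1 ltnS -has_count has_pred1.
  by apply: wf_word_max_occurs => //; rewrite -/(top s2); move: q0 qtop; clear; lia.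
have s's2 : perm_eq s' s2.
  have : perm_eq (rcons s' q) (rcons s2 q).
    by apply: perm_trans s12; rewrite perm_sym.
  by rewrite perm_rcons2.
have := wfs'; rewrite wf_rcons => /andP[wfs'1 _].
by apply: rel_trans R1 _; apply: rel_rcons => //; apply: IH.
Qed.

End reorder.

(** * One-variable calculus *)

Section derivatives.
Variable R : realType.
Local Open Scope classical_set_scope.

Lemma is_derive_linear_approx (f : R -> R) (x l : R) :
  (forall eps : R, 0 < eps -> exists2 delta : R, 0 < delta &
     forall h, `|h| < delta -> `|f (x + h) - f x - h * l| <= eps * `|h|) ->
  is_derive x 1 f l.
Proof.
move=> H.
have cl : (fun h : R => h^-1 *: (f (h *: 1 + x) - f x)) @ 0^' --> l.
  apply/cvgrPdist_le => eps e0.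
  have [delta d0 Hd] := H _ e0.
  near=> h.
  have h0 : h != 0 by near: h; exact: nbhs_dnbhs_neq.
  have hd : `|h| < delta.
    near: h; apply: dnbhs0_lt => //.
  have := Hd h hd.
  rewrite /GRing.scale/= mulr1 (addrC h) => H1.
  have -> : l - h^-1 * (f (x + h) - f x) = - (h^-1 * (f (x + h) - f x - h * l)).
    by field.
  by rewrite normrN normrM normfV ler_pdivrMl ?normr_gt0// [leRHS]mulrC.
split.
  by apply/cvg_ex; exists l.
by apply/cvg_lim.
Unshelve. all: by end_near.
Qed.

End derivatives.

Section mean_value.
Variable R : realType.

Lemma is_derive_translate (f : R -> R) (b l : R) :
  is_derive (0 : R) 1 (fun a => f (b + a)) l -> is_derive b 1 f l.
Proof.
case=> ex val; have E : (fun h : R => h^-1 *: (((fun a => f (b + a)) \o shift 0) (h *: 1) - f (b + 0)))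
   = (fun h : R => h^-1 *: ((f \o shift b) (h *: 1) - f b)).
  by apply/funext => h; rewrite /= !addr0 [b + _]addrC.
by split; [move: ex | move: val]; rewrite /derivable /derive E.
Qed.

Lemma mean_value (f df : R -> R) (b : R) : 0 < b ->
  (forall a, 0 <= a <= b -> is_derive a 1 f (df a)) ->
  exists2 a, 0 <= a <= b & f b - f 0 = b * df a.
Proof.
move=> b0 H; have [||a] := @MVT R f df 0 b b0.
- by move=> a; rewrite in_itv /= => /andP[a0 ab]; apply: H; rewrite !ltW.
- apply: derivable_within_continuous => a; rewrite in_itv /= => ab.
  by have [] := H a ab.
rewrite in_itv /= subr0 mulrC => /andP[a0 ab] ->; exists a => //.
by rewrite !ltW.
Qed.

Lemma eq_of_dist_le (a b K : R) :
  (forall t, 0 < t <= 1 -> `|a - b| <= K * t) -> a = b.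
Proof.
move=> H; apply/eqP; rewrite -subr_eq0 -normr_eq0; apply/eqP/le_anti.
rewrite normr_ge0 andbT; apply/ler_addgt0Pr => e e0; rewrite add0r.
pose t := Num.min 1 (e / (`|K| + 1)).
have K1 : 0 < `|K| + 1 by rewrite ltr_wpDl.
have t0 : 0 < t by rewrite lt_min ltr01 divr_gt0.
apply: (le_trans (H t _)); first by rewrite t0 ge_min lexx.
apply: (@le_trans _ _ ((`|K| + 1) * t)).
  by apply: ler_wpM2r; [exact: ltW | rewrite (le_trans (ler_norm K))// lerDl].
by rewrite -ler_pdivlMl// mulrC ge_min lexx orbT.
Qed.

End mean_value.

Section line_derivatives.
Variable R : realType.

Lemma is_derive_mulmx m n p (A : 'M[R]_(m, n)) (G : R -> 'M[R]_(n, p))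
    (G' : 'M[R]_(n, p)) (b : R) i j :
  (forall k, is_derive b 1 (fun a : R => G a k j) (G' k j)) ->
  is_derive b 1 (fun a : R => (A *m G a) i j) ((A *m G') i j).
Proof.
move=> H; rewrite mxE.
have := is_derive_sum (fun k => is_deriveZ (A i k) (H k)).
set f := (X in is_derive _ _ X _ -> _); set g := (X in _ -> is_derive _ _ X _).
suff -> : f = g by [].
by apply/funext => a; rewrite /f /g mxE fct_sumE; apply: eq_bigr.
Qed.

Lemma is_derive_line d p q (F : 'rV[R]_d -> 'M[R]_(p, q)) x h i j :
  differentiable F x ->
  is_derive (0 : R) 1 (fun a : R => F (x + a *: h) i j) ('d F x h i j).
Proof.
move=> dF; have dFh : derivable F x h by exact: diff_derivable.
have dFij := (derivable_mxP F x h).1 dFh i j.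
have <- : 'D_h (fun y => F y i j) x = 'd F x h i j.
  by rewrite -deriveE// derive_mx// mxE.
have E : (fun b : R => b^-1 *: (((fun a => F (x + a *: h) i j) \o shift 0) (b *: 1)
     - F (x + 0 *: h) i j)) =
   (fun b : R => b^-1 *: (((fun y => F y i j) \o shift x) (b *: h) - F x i j)).
  by apply/funext => b; rewrite /= scale0r !addr0 [b *: 1]mulr1 [x + _]addrC.
by split; rewrite /derivable /derive E.
Qed.

End line_derivatives.

(** * The Euclidean norm and Borel maps *)

Lemma norm_entry_le (R : realType) p q (M : 'M[R]_(p, q)) i j : `|M i j| <= `|M|.
Proof.
rewrite [leRHS]/Num.norm/= mx_normrE.
exact: (le_bigmax _ (fun ij : 'I_p * 'I_q => `|M ij.1 ij.2|) (i, j)).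
Qed.

Section enorm_theory.
Variables (R : realType) (d : nat).
Implicit Types x y z : 'rV[R]_d.

Lemma enorm_ge0 x : 0 <= enorm x. Proof. exact: sqrtr_ge0. Qed.

Lemma enorm_sqr x : enorm x ^+ 2 = \sum_(i < d) x 0 i ^+ 2.
Proof. by rewrite sqr_sqrtr//; apply: sumr_ge0 => i _; exact: sqr_ge0. Qed.

Lemma enorm0 : enorm (0 : 'rV[R]_d) = 0.
Proof. by rewrite /enorm big1 ?sqrtr0// => i _; rewrite mxE expr0n. Qed.

Lemma enormZ (a : R) x : enorm (a *: x) = `|a| * enorm x.
Proof.
rewrite /enorm -sqrtr_sqr -sqrtrM ?sqr_ge0// mulr_sumr.
by congr Num.sqrt; apply: eq_bigr => i _; rewrite mxE exprMn.
Qed.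

Lemma enorm_le_norm x : enorm x <= d%:R * `|x|.
Proof.
rewrite -[leRHS]ger0_norm ?mulr_ge0// -sqrtr_sqr; apply: ler_wsqrtr.
apply: (@le_trans _ _ (\sum_(i < d) `|x| ^+ 2)).
  apply: ler_sum => i _; rewrite -[leLHS]real_normK ?num_real//.
  by rewrite lerXn2r ?nnegrE// norm_entry_le.
rewrite sumr_const card_ord -[leLHS]mulr_natl exprMn ler_wpM2r ?sqr_ge0//.
by rewrite -natrX ler_nat; case: (d) => // n; rewrite expnS expn1 leq_pmulr.
Qed.

Lemma enorm_sqrB x y : enorm (x - y) ^+ 2 <= 2 * enorm x ^+ 2 + 2 * enorm y ^+ 2.
Proof.
rewrite !enorm_sqr !mulr_sumr -big_split/=; apply: ler_sum => i _.
by rewrite !mxE; have := sqr_ge0 (x 0 i + y 0 i); rewrite !expr2; nra.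
Qed.

Lemma enorm_le_sqr x : enorm x <= 1 + enorm x ^+ 2.
Proof. by have := sqr_ge0 (enorm x - 1); rewrite !expr2; have := enorm_ge0 x; nra. Qed.

End enorm_theory.

Section borel_maps.
Variables (R : realType) (d : nat).

Lemma measurable_coord (i : 'I_d) :
  measurable_fun [set: borel R d] (fun x : borel R d => (x : 'rV[R]_d) 0 i).
Proof.
apply: (measurability _ (RGenOpens.measurableE R)) => _ [_ [a [b ->] <-]].
rewrite setTI; apply: sub_sigma_algebra.
by apply: open_comp; [move=> x _; exact: coord_continuous | exact: interval_open].
Qed.

Lemma open_measurable_borel (A : set 'rV[R]_d) : open A ->
  measurable (A : set (borel R d)).
Proof. exact: sub_sigma_algebra. Qed.

Lemma measurable_set1_borel (z : 'rV[R]_d) : measurable ([set z] : set (borel R d)).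
Proof.
rewrite -[X in measurable X]setCK; apply: measurableC.
apply: open_measurable_borel; apply: closed_openC.
exact: (accessible_closed_set1 (hausdorff_accessible (@norm_hausdorff _ _))).
Qed.

Lemma measurable_enorm dsp (T : measurableType dsp) (X Y : T -> borel R d) :
  measurable_fun setT X -> measurable_fun setT Y ->
  measurable_fun setT (fun w => enorm ((X w : 'rV[R]_d) - Y w)).
Proof.
move=> mX mY; apply: measurableT_comp.
  by apply: continuous_measurable_fun; exact: sqrt_continuous.
apply: measurable_sum => i; apply: measurable_funX.
under eq_fun do rewrite !mxE.
by apply: measurable_funB; apply: (measurableT_comp (measurable_coord i)).
Qed.

Lemma measurable_enorm_id : measurable_fun setT (fun x : borel R d => enorm (x : 'rV[R]_d)).
Proof.
rewrite (_ : (fun x => _) = (fun x : borel R d => enorm ((x : 'rV[R]_d) - 0))).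
  exact: (@measurable_enorm _ _ id (cst (0 : 'rV[R]_d))).
by apply/funext => x; rewrite subr0.
Qed.

Lemma measurable_enorm_sqr dsp (T : measurableType dsp) (X : T -> borel R d) :
  measurable_fun setT X ->
  measurable_fun setT (fun w => (enorm (X w : 'rV[R]_d) ^+ 2)%:E).
Proof.
move=> mX; apply/measurable_EFinP; apply: measurable_funX.
exact: (measurableT_comp measurable_enorm_id).
Qed.

End borel_maps.

(** * Perturbed laws *)

Section mixture.
Context dsp (T : measurableType dsp) (R : realType).
Variables (m1 m2 : probability T R) (t : R).
Hypothesis t01 : 0 <= t <= 1.

Fact mix_ge0 : 0 <= t. Proof. by case/andP: t01. Qed.
Fact mix_le1 : 0 <= 1 - t. Proof. by rewrite subr_ge0; case/andP: t01. Qed.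

Definition mix : set T -> \bar R :=
  measure_add (mscale (NngNum mix_le1) m1) (mscale (NngNum mix_ge0) m2).

HB.instance Definition _ := Measure.on mix.

Lemma mixE A : mix A = ((1 - t)%:E * m1 A + t%:E * m2 A)%E.
Proof. by rewrite /mix measure_addE. Qed.

Fact mix_setT : mix setT = 1%E.
Proof. by rewrite mixE !probability_setT !mule1 -EFinD subrK. Qed.

HB.instance Definition _ := Measure_isProbability.Build _ _ _ mix mix_setT.

Lemma ge0_integral_mix (f : T -> \bar R) : measurable_fun [set: T] f ->
  (forall x, 0 <= f x)%E ->
  (\int[mix]_x f x = (1 - t)%:E * \int[m1]_x f x + t%:E * \int[m2]_x f x)%E.
Proof.
move=> mf f0; rewrite (@ge0_integral_measure_add _ T R _ _ setT)//.
by rewrite !(@ge0_integral_mscale _ T R _ setT).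
Qed.
End mixture.

Section perturbed_law.
Variables (R : realType) (d : nat).
Implicit Types (mu : P2 R d) (v z : 'rV[R]_d).
Local Open Scope classical_set_scope.

(** Sends the ball of radius [r] about [v] to a single point of its complement.
    The image of any law thus gives the ball no mass, while no point moves by
    more than a multiple of [r]. *)
Definition clear_ball v (r : R) (x : borel R d) : borel R d :=
  if `|(x : 'rV[R]_d) - v| < r then v + const_mx r else x.

Lemma measurable_norm_ball v (r : R) :
  measurable ([set x | `|x - v| < r] : set (borel R d)).
Proof.
apply: open_measurable_borel; rewrite (_ : mkset _ = ball v r).
  exact: ball_open.
by rewrite -ball_normE; apply/seteqP; split=> x /=; rewrite distrC.
Qed.

Lemma measurable_clear_ball v (r : R) : measurable_fun setT (clear_ball v r).
Proof.
apply: measurable_fun_ifT => //.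
apply: (@measurable_fun_bool _ _ _ _ true); rewrite setTI.
rewrite [X in measurable X](_ : _ = [set x | `|x - v| < r]).
  exact: measurable_norm_ball.
by apply/seteqP; split.
Qed.

HB.instance Definition _ v r := isMeasurableFun.Build _ _ _ _ (clear_ball v r)
  (measurable_clear_ball v r).

Lemma clear_ball_avoids v (r : R) (x : borel R d) : (0 < d)%N -> 0 < r ->
  r <= `|(clear_ball v r x : 'rV[R]_d) - v|.
Proof.
move=> d0 r0; rewrite /clear_ball; case: ltP => // _.
rewrite addrC addKr; have := norm_entry_le (const_mx r : 'rV[R]_d) 0 (Ordinal d0).
by rewrite mxE gtr0_norm.
Qed.

Lemma clear_ball_dist v (r : R) (x : borel R d) : 0 <= r ->
  enorm ((x : 'rV[R]_d) - clear_ball v r x) <= d%:R * (2 * r).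
Proof.
move=> r0; rewrite /clear_ball; case: ltP => xv; last first.
  by rewrite subrr enorm0 !mulr_ge0.
apply: (le_trans (enorm_le_norm _)); apply: ler_wpM2l => //.
rewrite opprD addrA mulrDl mul1r; apply: (le_trans (ler_normB _ _)).
apply: lerD; first exact: ltW.
rewrite [leLHS]/Num.norm/= mx_normrE; apply: bigmax_le => // -[i j] _.
by rewrite /= mxE ger0_norm.
Qed.

Section def.
Variables (mu : P2 R d) (v : 'rV[R]_d) (r t : R).
Hypothesis t01 : 0 <= t <= 1.

(** An atom of mass [t] at [z], with no other mass in the ball about [v]. The atom
    is written as the image of [mu] by a constant map, so that both parts of the
    mixture are images of [mu] and can be coupled through [mu]. *)
Definition perturb_prob z : probability (borel R d) R :=
  mix (distribution mu (clear_ball v r)) (distribution mu (cst (z : borel R d))) t01.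

Lemma perturb_moment z : (\int[perturb_prob z]_x (enorm (x : 'rV[R]_d) ^+ 2)%:E < +oo)%E.
Proof.
rewrite ge0_integral_mix; first last.
- by move=> x; rewrite lee_fin sqr_ge0.
- exact: measurable_enorm_sqr.
rewrite !ge0_integral_distribution; try exact: measurable_enorm_sqr;
  try by move=> x; rewrite lee_fin sqr_ge0.
apply: lte_add_pinfty; last first.
  by rewrite (integral_cst mu measurableT (enorm z ^+ 2)%:E)/= probability_setT mule1 -EFinM ltry.
apply: lte_mul_pinfty; [by rewrite lee_fin mix_le1 | by [] |].
apply: (@le_lt_trans _ _ (\int[mu]_x ((enorm (x : 'rV[R]_d) ^+ 2)%:E +
   (enorm (v + const_mx r) ^+ 2)%:E))%E).
  apply: ge0_le_integral => //.
  - by move=> x _; rewrite lee_fin sqr_ge0.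
  - by apply: measurable_enorm_sqr; exact: measurable_clear_ball.
  - by apply: emeasurable_funD => //; exact: measurable_enorm_sqr.
  - move=> x _; rewrite -EFinD lee_fin /= /clear_ball; case: ifP => _.
      by rewrite lerDr sqr_ge0.
    by rewrite lerDl sqr_ge0.
rewrite ge0_integralD//=.
- rewrite integral_cst//= lte_add_pinfty ?P2_moment// probability_setT mule1.
  by rewrite ltry.
- by move=> x _; rewrite lee_fin sqr_ge0.
- exact: measurable_enorm_sqr.
- by move=> x _; rewrite lee_fin sqr_ge0.
Qed.

Definition perturb z : P2 R d := MkP2 (perturb_moment z).

Lemma perturbE z A : perturb z A =
  ((1 - t)%:E * mu (clear_ball v r @^-1` A) + t%:E * mu (cst z @^-1` A))%E.
Proof. by rewrite /perturb/= mixE. Qed.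

End def.

Lemma W1_ge0 mu nu : (0 <= W1 mu nu)%E.
Proof.
apply: le_ereal_inf_tmp => _ [pi _ <-]; apply: integral_ge0 => x _.
by rewrite lee_fin enorm_ge0.
Qed.

(** The mixture of the laws of [(X1, Y1)] and [(X2, Y2)] under [mu] is a
    coupling of the two mixtures. *)
Lemma W1_mix (mu mu1 mu2 : P2 R d) (X1 X2 Y1 Y2 : {mfun borel R d >-> borel R d}) (t : R) :
  0 <= t <= 1 ->
  (forall A, measurable A ->
     mu1 A = (1 - t)%:E * mu (X1 @^-1` A) + t%:E * mu (X2 @^-1` A))%E ->
  (forall A, measurable A ->
     mu2 A = (1 - t)%:E * mu (Y1 @^-1` A) + t%:E * mu (Y2 @^-1` A))%E ->
  (W1 mu1 mu2 <=
   (1 - t)%:E * \int[mu]_x (enorm ((X1 x : 'rV[R]_d) - Y1 x))%:E +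
   t%:E * \int[mu]_x (enorm ((X2 x : 'rV[R]_d) - Y2 x))%:E)%E.
Proof.
move=> t01 mu1E mu2E.
have mXY (X Y : {mfun borel R d >-> borel R d}) :
    measurable_fun setT (fun x => (X x, Y x)) by exact: measurable_fun_pair.
pose XY (X Y : {mfun borel R d >-> borel R d}) : {mfun borel R d >-> (borel R d * borel R d)%type} :=
  HB.pack (fun x => (X x, Y x)) (isMeasurableFun.Build _ _ _ _ _ (mXY X Y)).
pose pi := mix (distribution mu (XY X1 Y1)) (distribution mu (XY X2 Y2)) t01.
have mcost : measurable_fun setT (fun z : borel R d * borel R d =>
    (enorm ((z.1 : 'rV[R]_d) - z.2))%:E).
  by apply/measurable_EFinP; apply: measurable_enorm.
apply: ereal_inf_lbound; exists pi.
  move=> A mA; split; rewrite /pi/= mixE.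
    by rewrite mu1E// /distribution/pushforward/=; congr (_ * mu _ + _ * mu _)%E;
      apply/seteqP; split=> x //= -[].
  by rewrite mu2E// /distribution/pushforward/=; congr (_ * mu _ + _ * mu _)%E;
    apply/seteqP; split=> x //= -[].
rewrite ge0_integral_mix//; last by move=> z; rewrite lee_fin enorm_ge0.
by rewrite !ge0_integral_distribution// => z; rewrite lee_fin enorm_ge0.
Qed.

End perturbed_law.

Section perturbation_W1.
Variables (R : realType) (d : nat).
Implicit Types (mu : P2 R d) (v z : 'rV[R]_d).
Local Open Scope classical_set_scope.

(** Only the atom has to be transported. *)
Lemma W1_perturb mu v (r t : R) (t01 : 0 <= t <= 1) z z' :
  (W1 (perturb mu v r t01 z) (perturb mu v r t01 z') <= (t * enorm (z - z'))%:E)%E.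
Proof.
apply: le_trans.
  apply: (@W1_mix _ _ mu _ _ (clear_ball v r) (cst (z : borel R d))
    (clear_ball v r) (cst (z' : borel R d)) _ t01) => A _; exact: perturbE.
rewrite /= (eq_integral (cst 0%:E)) => [|x _]; last by rewrite subrr enorm0.
by rewrite !integral_cst//= probability_setT mul0e mule0 add0e mule1 EFinM.
Qed.

Lemma moment_sub_finite mu v :
  (\int[mu]_x (enorm ((x : 'rV[R]_d) - v))%:E < +oo)%E.
Proof.
apply: (@le_lt_trans _ _ (\int[mu]_x ((2%:E * (enorm (x : 'rV[R]_d) ^+ 2)%:E) +
   (1 + 2 * enorm v ^+ 2)%:E))%E).
  apply: ge0_le_integral => //.
  - by move=> x _; rewrite lee_fin enorm_ge0.
  - by apply/measurable_EFinP; apply: (measurable_enorm (X := id) (Y := cst (v : borel R d))).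
  - apply: emeasurable_funD => //; apply: measurable_funeM.
    exact: measurable_enorm_sqr.
  - move=> x _; rewrite -EFinM -EFinD lee_fin.
    apply: (le_trans (enorm_le_sqr _)).
    rewrite [leRHS]addrCA lerD2l; exact: enorm_sqrB.
rewrite ge0_integralD//=.
- rewrite integral_cst//= probability_setT mule1 lte_add_pinfty ?ltry//.
  rewrite ge0_integralZl//=.
  + by rewrite lte_mul_pinfty// P2_moment.
  + exact: measurable_enorm_sqr.
  + by move=> x _; rewrite lee_fin sqr_ge0.
- by move=> x _; rewrite -EFinM lee_fin mulr_ge0 ?sqr_ge0.
- by apply: measurable_funeM; exact: measurable_enorm_sqr.
- by move=> x _; rewrite lee_fin addr_ge0// mulr_ge0// sqr_ge0.
Qed.

Lemma mule_convex (t : R) (x : \bar R) : 0 <= t <= 1 ->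
  x = ((1 - t)%:E * x + t%:E * x)%E.
Proof.
move=> /andP[t0 t1].
by rewrite -ge0_muleDl ?lee_fin ?subr_ge0// -EFinD subrK mul1e.
Qed.

(** A part [1 - t] of [mu] is transported by [clear_ball] over a distance of
    order [r], the part [t] is gathered at [v]. What matters is that [C] depends
    on neither [r] nor [t]. *)
Lemma W1_perturb_base mu v : exists2 C : R, 0 <= C &
  forall (r t : R) (t01 : 0 <= t <= 1), 0 <= r ->
  (W1 mu (perturb mu v r t01 v) <= (d%:R * (2 * r) + t * C)%:E)%E.
Proof.
pose I := (\int[mu]_x (enorm ((x : 'rV[R]_d) - v))%:E)%E.
have I0 : (0 <= I)%E by apply: integral_ge0 => x _; rewrite lee_fin enorm_ge0.
have If : I \is a fin_num by rewrite ge0_fin_numE// moment_sub_finite.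
exists (fine I); first exact: fine_ge0.
move=> r t t01 r0; apply: le_trans.
  pose idm : {mfun borel R d >-> borel R d} := HB.pack (fun x : borel R d => x)
    (isMeasurableFun.Build _ _ _ _ _ (@measurable_id _ (borel R d) setT)).
  have muE A : measurable A ->
      mu A = ((1 - t)%:E * mu (idm @^-1` A) + t%:E * mu (idm @^-1` A))%E.
    move=> _; have -> : idm @^-1` A = A by [].
    exact: mule_convex.
  apply: (@W1_mix _ _ mu mu _ idm idm
    (clear_ball v r) (cst (v : borel R d)) _ t01) => A mA; last exact: perturbE.
  exact: muE.
rewrite [leRHS]EFinD [(t * _)%:E]EFinM fineK//; apply: leeD => //.
have : (\int[mu]_x (enorm ((x : 'rV[R]_d) - clear_ball v r x))%:E <=
        \int[mu]_x (cst (d%:R * (2 * r))%:E x))%E.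
  apply: ge0_le_integral => //.
  - by move=> x _; rewrite lee_fin enorm_ge0.
  - by apply/measurable_EFinP; apply: (measurable_enorm (X := id)).
  - by move=> x _; rewrite lee_fin; exact: clear_ball_dist.
rewrite integral_cst//= probability_setT mule1 => h.
rewrite -[leRHS]mul1e; apply: lee_pmul => //.
- by rewrite lee_fin mix_le1.
- by apply: integral_ge0 => x _; rewrite lee_fin enorm_ge0.
- by rewrite lee_fin lerBlDr lerDl mix_ge0.
Qed.

End perturbation_W1.

(** * Moving an atom *)

Section lions_perturb.
Context {R : realType} {disp : measure_display} {Om : measurableType disp}.
Variables (P : probability Om R) (d : nat).
Local Open Scope classical_set_scope.

Definition move_on (X : {RV P >-> borel R d}) (z y : 'rV[R]_d) (w : Om) : borel R d :=
  if (X w : 'rV[R]_d) == z then y else X w.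

Lemma measurable_level (X : {RV P >-> borel R d}) (z : 'rV[R]_d) :
  measurable (X @^-1` [set z]).
Proof.
rewrite -[X in measurable X]setTI; apply: measurable_funP => //.
exact: measurable_set1_borel.
Qed.

Lemma measurable_move_on X z y : measurable_fun setT (move_on X z y).
Proof.
apply: measurable_fun_ifT => //.
apply: (@measurable_fun_bool _ _ _ _ true); rewrite setTI.
rewrite [X in measurable X](_ : _ = X @^-1` [set z]); first exact: measurable_level.
by apply/seteqP; split=> w /= /eqP.
Qed.

HB.instance Definition _ X z y := isMeasurableFun.Build _ _ _ _ (move_on X z y)
  (measurable_move_on X z y).

(** Variations of [X] supported by the event [X = z] have constant increments
    there, so that all integrals in the definition of the Lions derivative are
    explicit. *)
Lemma Rintegral_on_level (X : {RV P >-> borel R d}) z (c : R) (f : Om -> R) :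
  (forall w, (X w : 'rV[R]_d) = z -> f w = c) ->
  (forall w, (X w : 'rV[R]_d) <> z -> f w = 0) ->
  \int[P]_w f w = c * fine (P (X @^-1` [set z])).
Proof.
move=> fc f0; rewrite -Rintegral_cst; last exact: measurable_level.
rewrite [RHS]Rintegral_mkcond; apply: eq_Rintegral => w _.
rewrite patchE; case: ifPn => [|/negP]; rewrite inE => wz; first exact: fc.
exact: f0.
Qed.

Lemma in_L2_move_on X z y : in_L2 (P := P) X -> in_L2 (P := P) (move_on X z y).
Proof.
rewrite /in_L2 => XL2.
apply: (@le_lt_trans _ _ (\int[P]_w ((enorm (X w : 'rV[R]_d) ^+ 2)%:E +
   (enorm y ^+ 2)%:E))%E).
  apply: ge0_le_integral => //.
  - by move=> w _; rewrite lee_fin sqr_ge0.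
  - by apply: measurable_enorm_sqr; exact: measurable_move_on.
  - by apply: emeasurable_funD => //; apply: measurable_enorm_sqr.
  - move=> w _; rewrite -EFinD lee_fin /= /move_on; case: ifP => _.
      by rewrite lerDr sqr_ge0.
    by rewrite lerDl sqr_ge0.
rewrite ge0_integralD//=.
- rewrite integral_cst//= lte_add_pinfty// probability_setT mule1.
  by rewrite ltry.
- by move=> x _; rewrite lee_fin sqr_ge0.
- by apply: measurable_enorm_sqr.
- by move=> x _; rewrite lee_fin sqr_ge0.
Qed.

Section at_perturbation.
Variables (mu : P2 R d) (v : 'rV[R]_d) (r t : R).
Hypotheses (d0 : (0 < d)%N) (r0 : 0 < r) (t01 : 0 <= t <= 1).
Variables (z : 'rV[R]_d) (X : {RV P >-> borel R d}).
Hypotheses (zv : `|z - v| < r) (Xlaw : has_law (P := P) X (perturb mu v r t01 z)).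

Lemma clear_ball_preim1 : clear_ball v r @^-1` [set z] = set0.
Proof.
rewrite -subset0 => x /= xz; have := clear_ball_avoids v x d0 r0.
by rewrite xz leNgt zv.
Qed.

Lemma prob_level : P (X @^-1` [set z]) = t%:E.
Proof.
rewrite Xlaw; last exact: measurable_set1_borel.
rewrite perturbE clear_ball_preim1 measure0 mule0 add0e.
rewrite (_ : cst z @^-1` [set z] = setT) ?probability_setT ?mule1//.
by apply/seteqP; split.
Qed.

(** Moving the value of [X] on the event [X = z] moves the atom and nothing
    else, because the rest of the law does not charge [z]. *)
Lemma has_law_move_on y : has_law (P := P) (move_on X z y) (perturb mu v r t01 y).
Proof.
move=> A mA; have mz := measurable_set1_borel z.
have mAz : measurable (A `\ z : set (borel R d)) by exact: measurableD.
have PAz : P (X @^-1` (A `\ z)) = ((1 - t)%:E * mu (clear_ball v r @^-1` A))%E.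
  rewrite Xlaw// perturbE (_ : cst z @^-1` _ = set0) ?measure0 ?mule0 ?adde0.
    congr (_ * mu _)%E; apply/seteqP; split=> x /= => [[]//|Ax]; split=> // xz.
    by have : (clear_ball v r @^-1` [set z]) x by []; rewrite clear_ball_preim1.
  by rewrite -subset0 => x /= [].
rewrite perturbE; have [yA|yA] := pselect (A y).
  rewrite (_ : cst y @^-1` A = setT) ?probability_setT ?mule1; last first.
    by apply/seteqP; split.
  rewrite -PAz addeC -prob_level -measureU; first last.
  - by apply/seteqP; split=> w //= -[-> [_]].
  - by rewrite -[X in measurable X]setTI; exact: measurable_funP.
  - exact: measurable_level.
  congr (P _); apply/seteqP; split=> w /=; rewrite /move_on; case: eqP => //.
  - by left.
  - by right; split.
  - by move=> nz [|[]].
rewrite (_ : cst y @^-1` A = set0) ?measure0 ?mule0 ?adde0; last first.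
  by rewrite -subset0 => x.
rewrite -PAz; congr (P _); apply/seteqP; split=> w /=; rewrite /move_on;
  case: eqP => wz //; first by case.
by case.
Qed.

End at_perturbation.

(** The variation of [X] which moves the atom from [z] to [z + s *: k] has
    L2 norm [|s| * sqrt t * enorm k], and the Lions derivative pairs with it to
    [s * (t * D z k)]. *)
Lemma lions_derivative_move_atom p q (g : P2 R d -> 'M[R]_(p, q)) D mu
    (v : 'rV[R]_d) (r t : R) (t01 : 0 <= t <= 1) (z k : 'rV[R]_d) i j :
  (0 < d)%N -> 0 < r -> `|z - v| < r ->
  is_lions_derivative P g (perturb mu v r t01 z) D ->
  is_derive (0 : R) 1 (fun s : R => g (perturb mu v r t01 (z + s *: k)) i j)
    (t * D z k i j).
Proof.
move=> d0 r0 zv [Dlin _ [X [XL2 Xlaw HX]]].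
have t0 := mix_ge0 t01.
have PA := prob_level d0 r0 zv Xlaw.
apply: is_derive_linear_approx => eps e0.
pose c := enorm k * Num.sqrt t.
have c0 : 0 <= c by rewrite mulr_ge0 ?sqrtr_ge0 ?enorm_ge0.
have c1 : 0 < c + 1 by rewrite ltr_wpDl.
have [delta dl0 Hdl] := HX (eps / (c + 1)) (divr_gt0 e0 c1).
exists (delta / (c + 1)); first exact: divr_gt0.
move=> h hd.
pose Y : {RV P >-> borel R d} := move_on X z (z + h *: k).
have YX w : (Y w : 'rV[R]_d) - X w = if (X w : 'rV[R]_d) == z then h *: k else 0.
  rewrite /Y/= /move_on; case: eqP => [->|_]; last by rewrite subrr.
  by rewrite addrC addKr.
have L2 : L2dist (P := P) X Y = `|h| * c.
  rewrite /L2dist (Rintegral_on_level (X := X) (z := z) (c := enorm (h *: k) ^+ 2)).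
  - rewrite PA /= sqrtrM ?sqr_ge0// sqrtr_sqr ger0_norm ?enorm_ge0//.
    by rewrite enormZ mulrA.
  - by move=> w wz; rewrite YX wz eqxx.
  - by move=> w /eqP/negPf wz; rewrite YX wz enorm0 expr0n.
have Dint a b : \int[P]_w (D (X w) ((Y w : 'rV[R]_d) - X w) a b) = h * (t * D z k a b).
  rewrite (Rintegral_on_level (X := X) (z := z) (c := h * D z k a b)).
  - by rewrite PA /= mulrAC mulrA.
  - move=> w wz; rewrite YX wz eqxx.
    have /(_ h k 0) := Dlin z; rewrite !addr0 => ->.
    have -> : D z 0 = 0 by have := Dlin z (-1) 0 0; rewrite scaler0 addr0 scaleN1r addNr.
    by rewrite addr0 mxE.
  - move=> w /eqP/negPf wz; rewrite YX wz.
    have -> : D (X w) 0 = 0.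
      by have := Dlin (X w) (-1) 0 0; rewrite scaler0 addr0 scaleN1r addNr.
    by rewrite mxE.
have := Hdl Y _ (in_L2_move_on _ _ XL2)
  (has_law_move_on d0 r0 zv Xlaw (z + h *: k)).
have hc : `|h| * c <= `|h| * (c + 1) by rewrite ler_wpM2l// lerDl.
rewrite L2 => /(_ (le_lt_trans hc _)); rewrite -ltr_pdivlMr// => /(_ hd) H.
rewrite add0r scale0r addr0 -Dint.
have := le_trans (norm_entry_le _ i j) H; rewrite !mxE => /le_trans; apply.
rewrite mulrAC ler_pdivrMr// -mulrA; apply: ler_wpM2l hc; exact: ltW.
Qed.

End lions_perturb.

(** * Symmetry of the mixed derivatives *)

Section calculus.
Variables (R : realType) (d N : nat).
Notation V := 'rV[R]_d.
Notation token := (nat * V)%type.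
Notation top s := (max_label (map fst s)).
Notation wf s := (wf_word (map fst s)).
Implicit Types (s w : seq token) (x h k : V) (mu nu : P2 R d) (v : nat -> V).

(** The bound on [W1] is passed as a real number [B], which keeps extended
    reals out of the estimates. *)
Definition lipschitz_with (E : seq token -> V -> P2 R d -> (nat -> V) -> R) s (C : R) :=
  0 <= C /\
  forall (x y : V) mu nu (v v' : nat -> V) (B : R), (W1 mu nu <= B%:E)%E ->
    `|E s x mu v - E s y nu v'| <=
      C * (enorm (x - y) + \sum_(j < top s) enorm (v j.+1 - v' j.+1) + B).

(** What the argument retains of a family of derivatives: [E s x mu v] is the
    value, along the word of labels of [s], on the tensor product of the vectors
    of [s]. The Lions derivative enters through the motion of an atom only. *)
Record derivative_calculus (E : seq token -> V -> P2 R d -> (nat -> V) -> R) : Prop := {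
  dc_x : forall s x mu v h, wf s -> (size s < N)%N ->
    is_derive (0 : R) 1 (fun a : R => E s (x + a *: h) mu v)
      (E (rcons s (0%N, h)) x mu v);
  dc_v : forall s x mu v p h, wf s -> (size s < N)%N -> (1 <= p <= top s)%N ->
    is_derive (0 : R) 1 (fun a : R => E s x mu [eta v with p |-> v p + a *: h])
      (E (rcons s (p, h)) x mu v);
  dc_mu : forall s x mu v h (v0 : V) (r t : R) (t01 : 0 <= t <= 1) (z : V),
    wf s -> (size s < N)%N -> 0 < r -> `|z - v0| < r ->
    is_derive (0 : R) 1 (fun a : R => E s x (perturb mu v0 r t01 (z + a *: h)) v)
      (t * E (rcons s ((top s).+1, h)) x (perturb mu v0 r t01 z)
             [eta v with (top s).+1 |-> z]);
  dc_lipschitz : forall s, wf s -> (0 < size s <= N)%N -> exists C, lipschitz_with E s C;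
  dc_ext : forall s x mu (v v' : nat -> V),
    (forall j, (1 <= j <= top s)%N -> v j = v' j) ->
    E s x mu v = E s x mu v' }.

Variable E : seq token -> V -> P2 R d -> (nat -> V) -> R.
Hypothesis EP : derivative_calculus E.

(** Addition of [h] to the [c]-th vector. The sequences [q] it acts on hold all
    the variables of a derivative, [q 0] being [x] and [q j] being [v_j], so that
    label [c] means differentiation in the [c]-th vector. *)
Definition translate c h (q : nat -> V) : nat -> V :=
  fun n => if n == c then q n + h else q n.

Lemma translateC c1 c2 h k q : translate c1 h (translate c2 k q) = translate c2 k (translate c1 h q).
Proof.
apply/funext => n; rewrite /translate; case: (n == c1); case: (n == c2) => //.
by rewrite addrAC.
Qed.

Lemma translateD c h k q : translate c (h + k) q = translate c k (translate c h q).
Proof. by apply/funext => n; rewrite /translate; case: eqP => //; rewrite addrA. Qed.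

Lemma enorm_translate c h q n : enorm (translate c h q n - q n) = if n == c then enorm h else 0.
Proof. by rewrite /translate; case: eqP => _; rewrite ?subrr ?enorm0// addrC addKr. Qed.

Lemma sum_enorm_translate c h q n :
  \sum_(j < n) enorm (translate c h q j.+1 - q j.+1) <= enorm h.
Proof.
under eq_bigr do rewrite enorm_translate.
rewrite -big_mkcond /=.
have [j /eqP <-|none] := pickP (fun j : 'I_n => j.+1 == c).
  by rewrite (big_pred1 j)// => i /=; rewrite eqSS -val_eqE.
by rewrite big_pred0// enorm_ge0.
Qed.

Lemma translate0 c q : translate c 0 q = q.
Proof. by apply/funext => n; rewrite /translate; case: eqP => //; rewrite addr0. Qed.

Lemma top_rcons s p : top (rcons s p) = maxn (top s) p.1.
Proof. by rewrite map_rcons max_label_rcons. Qed.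

Lemma wf_rcons s p : wf (rcons s p) = wf s && (p.1 <= (top s).+1)%N.
Proof. by rewrite map_rcons wf_word_rcons. Qed.

Section along_atom.
Variables (mu : P2 R d) (v0 : V) (r t : R) (t01 : 0 <= t <= 1) (m : nat).
Hypotheses (r0 : 0 < r) (m0 : (0 < m)%N).

(** The [m]-th vector is both a variable and the position of the atom. For [m]
    the first unused label, moving it thus amounts to a Lions derivative. *)
Definition atom_value s (q : nat -> V) : R :=
  E s (q 0%N) (perturb mu v0 r t01 (q m)) q.

(** The factor produced by a derivative in the [c]-th vector: moving the atom
    alone, when [m] is not yet a variable, gives [t] times the Lions derivative. *)
Definition atom_weight s c : R := if (c == m) && (top s < m)%N then t else 1.

Lemma is_derive_atom_value s c h q : wf s -> (size s < N)%N ->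
  (c <= m <= (top s).+1)%N -> (c == m) ==> (top s < m)%N ->
  `|q m - v0| < r ->
  is_derive (0 : R) 1 (fun a : R => atom_value s (translate c (a *: h) q))
    (atom_weight s c * atom_value (rcons s (c, h)) q).
Proof.
move=> ws sN /andP[cs sm] cm qm; rewrite /atom_weight /atom_value.
have [cE|cm'] := eqVneq c m.
  move: cm; rewrite cE eqxx /= => sltm; rewrite sltm.
  have mE : m = (top s).+1 by apply/eqP; rewrite eqn_leq sm sltm.
  have := dc_mu EP (q 0%N) mu q h t01 ws sN r0 qm; rewrite -mE.
  have -> : ([eta q with m |-> q m] : nat -> V) = q by apply/funext => n /=; case: eqP => [->|].
  set f := (X in is_derive _ _ X _); set g := (X in _ -> is_derive _ _ X _).
  suff -> : f = g by [].
  apply/funext => a; rewrite /f /g {1 2}/translate eqxx eq_sym (gtn_eqF m0).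
  apply: (dc_ext EP) => j /andP[_ js]; rewrite /translate.
  by case: eqP => // jm; move: sltm; rewrite -jm ltnNge js.
rewrite /= mul1r.
have cs' : (c <= top s)%N.
  by rewrite -ltnS (leq_trans _ sm)// ltn_neqAle cm'.
have [c0|c0] := eqVneq c 0%N.
  have := dc_x EP (q 0%N) (perturb mu v0 r t01 (q m)) q h ws sN; rewrite c0.
  set f := (X in is_derive _ _ X _); set g := (X in _ -> is_derive _ _ X _).
  suff -> : f = g by [].
  apply/funext => a; rewrite /f /g {1 2}/translate (gtn_eqF m0) eqxx.
  apply: (dc_ext EP) => j /andP[j0 _]; rewrite /translate.
  by rewrite gtn_eqF.
have cb : (1 <= c <= top s)%N by rewrite lt0n c0.
have := dc_v EP (q 0%N) (perturb mu v0 r t01 (q m)) q h ws sN cb.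
set f := (X in is_derive _ _ X _); set g := (X in _ -> is_derive _ _ X _).
suff -> : f = g by [].
apply/funext => a; rewrite /f /g {1 2}/translate eq_sym (negPf c0) eq_sym (negPf cm').
by congr E; apply/funext => n; rewrite /translate /=; case: eqP => // ->.
Qed.

Lemma atom_value_translate s C c h q : lipschitz_with E s C ->
  `|atom_value s (translate c h q) - atom_value s q| <= C * (2 * enorm h).
Proof.
move=> [C0 HC]; rewrite /atom_value.
have := W1_perturb mu v0 r t01 (translate c h q m) (q m).
move=> /HC/le_trans; apply; apply: ler_wpM2l => //.
rewrite mulrDl mul1r; apply: lerD; last first.
  rewrite -[leRHS]mul1r; apply: ler_pM; rewrite ?enorm_ge0//.
  - by case/andP: t01.
  - by case/andP: t01.
  - by rewrite enorm_translate; case: ifP => // _; rewrite enorm_ge0.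
rewrite enorm_translate; have [<-|c0] := eqVneq 0%N c.
  by rewrite big1 ?addr0// => j _; rewrite enorm_translate.
by rewrite add0r sum_enorm_translate.
Qed.

Lemma is_derive_atom_value_at s c h q (a : R) : wf s -> (size s < N)%N ->
  (c <= m <= (top s).+1)%N -> (c == m) ==> (top s < m)%N ->
  `|translate c (a *: h) q m - v0| < r ->
  is_derive a 1 (fun a : R => atom_value s (translate c (a *: h) q))
    (atom_weight s c * atom_value (rcons s (c, h)) (translate c (a *: h) q)).
Proof.
move=> ws sN csm cm qm; apply: is_derive_translate.
have := is_derive_atom_value h ws sN csm cm qm.
set f := (X in is_derive _ _ X _); set g := (X in _ -> is_derive _ _ X _).
suff -> : f = g by [].
by apply/funext => b; rewrite /f /g scalerDl translateD.
Qed.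

Lemma atom_weight_ge0 s c : 0 <= atom_weight s c.
Proof. by rewrite /atom_weight; case: ifP => // _; case/andP: t01. Qed.

(** A first-order expansion with a remainder of second order in [eta], up to a
    term in [eta * t]. The latter is due to the case where [m] is already a
    variable of [s]: its motion also moves the atom in the measure, which by the
    Lipschitz property in the measure changes the value by [O(eta * t)]. *)
Lemma atom_value_increment s c k q (eta C1 C2 : R) : wf s -> (size s < N)%N ->
  (c <= m <= (top s).+1)%N -> (top s <= m)%N -> 0 < eta ->
  lipschitz_with E s C1 -> lipschitz_with E (rcons s (c, k)) C2 ->
  (forall a, 0 <= a <= eta -> `|translate c (a *: k) q m - v0| < r) ->
  `|atom_value s (translate c (eta *: k) q) - atom_value s q
    - eta * (atom_weight s c * atom_value (rcons s (c, k)) q)| <=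
  eta * (atom_weight s c * (C1 * (t * enorm k) + C2 * (2 * (eta * enorm k)))).
Proof.
move=> ws sN csm sm eta0 lip1 lip2 qm; have [t0 _] := andP t01.
have [cE|cN] := boolP ((c == m) ==> (top s < m)%N).
  have [a aeta] := mean_value eta0
    (fun a aeta => is_derive_atom_value_at ws sN csm cE (qm a aeta)).
  have [a0 ale] := andP aeta.
  rewrite scale0r translate0 => ->; rewrite -!mulrBr !normrM gtr0_norm//.
  rewrite ger0_norm ?atom_weight_ge0//.
  apply: ler_wpM2l; first exact: ltW.
  apply: ler_wpM2l; first exact: atom_weight_ge0.
  apply: (le_trans (atom_value_translate _ _ _ lip2)).
  rewrite ler_wpDl ?mulr_ge0 ?enorm_ge0//; first by case: lip1.
  apply: ler_wpM2l; first by case: lip2.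
  by rewrite ler_pM2l// enormZ ger0_norm// ler_wpM2r// enorm_ge0.
have [cE sE] : c = m /\ top s = m.
  move: cN; rewrite negb_imply -leqNgt => /andP[/eqP -> ms]; split=> //.
  by apply/eqP; rewrite eqn_leq sm ms.
subst c; rewrite /atom_weight eqxx sE ltnn /= !mul1r.
(* [f] moves the variable [v_m] while the atom stays at [q m] *)
pose f a := E s (q 0%N) (perturb mu v0 r t01 (q m)) (translate m (a *: k) q).
pose df a := E (rcons s (m, k)) (q 0%N) (perturb mu v0 r t01 (q m)) (translate m (a *: k) q).
have fdf a : 0 <= a <= eta -> is_derive a 1 f (df a).
  move=> _; apply: is_derive_translate.
  have mtop : (1 <= m <= top s)%N by rewrite m0 sE /=.
  have := dc_v EP (q 0%N) (perturb mu v0 r t01 (q m)) (translate m (a *: k) q) k ws sN mtop.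
  set g := (X in is_derive _ _ X _); set g' := (X in _ -> is_derive _ _ X _).
  suff -> : g = g' by [].
  apply/funext => b; rewrite /g /g' /f scalerDl translateD; congr E.
  by set q' := translate m _ q; apply/funext => n; rewrite /translate /=; case: eqP => // ->.
have [a /andP[a0 ale]] := mean_value eta0 fdf.
rewrite /f scale0r translate0 => fE.
have q0 h : translate m h q 0%N = q 0%N by rewrite /translate eq_sym (gtn_eqF m0).
have W0 z : (W1 (perturb mu v0 r t01 z) (perturb mu v0 r t01 z) <= 0%:E)%E.
  by have := W1_perturb mu v0 r t01 z z; rewrite subrr enorm0 mulr0.
have h1 : `|atom_value s (translate m (eta *: k) q) - f eta| <= eta * (C1 * (t * enorm k)).
  rewrite /atom_value /f q0.
  have [C0 /(_ _ _ _ _ _ _ _ (W1_perturb mu v0 r t01 _ _))] := lip1.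
  move=> /(_ (q 0%N) (q 0%N) (translate m (eta *: k) q m) (q m)
     (translate m (eta *: k) q) (translate m (eta *: k) q)) /le_trans; apply.
  rewrite subrr enorm0 add0r big1 ?add0r => [|j _]; last by rewrite subrr enorm0.
  rewrite enorm_translate eqxx enormZ gtr0_norm// le_eqVlt; apply/orP; left; apply/eqP; ring.
have h2 : `|df a - atom_value (rcons s (m, k)) q| <= C2 * (2 * (eta * enorm k)).
  rewrite /atom_value /df; have [C0 /(_ _ _ _ _ _ _ _ (W0 _))] := lip2.
  move=> /(_ (q 0%N) (q 0%N) (q m) (translate m (a *: k) q) q) /le_trans; apply.
  apply: ler_wpM2l => //; rewrite subrr enorm0 add0r addr0.
  apply: (le_trans (sum_enorm_translate _ _ _ _)).
  rewrite enormZ ger0_norm// mulrA; apply: ler_wpM2r; first exact: enorm_ge0.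
  by rewrite (le_trans ale)// mulrDl mul1r lerDl ltW.
have -> : atom_value s (translate m (eta *: k) q) - atom_value s q
    - eta * atom_value (rcons s (m, k)) q =
    (atom_value s (translate m (eta *: k) q) - f eta)
    + eta * (df a - atom_value (rcons s (m, k)) q).
  by rewrite mulrBr -fE /f /atom_value; ring.
apply: (le_trans (ler_normD _ _)); rewrite [leRHS]mulrDr; apply: lerD => //.
rewrite normrM gtr0_norm//; apply: ler_wpM2l => //; exact: ltW.
Qed.

(** The second difference is symmetric in the two directions, which is what
    makes the two orders of differentiation comparable. *)
Definition mixed_difference w c1 c2 h k q (eta : R) : R :=
  let phi a b := atom_value w (translate c1 (a *: h) (translate c2 (b *: k) q)) in
  (phi eta eta - phi eta 0) - (phi 0 eta - phi 0 0).

(** Mean value theorem in direction [c1], applied to the difference between the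
    two values of the [c2]-th vector, followed by [atom_value_increment] in
    direction [c2]. *)
Lemma mixed_difference_approx w c1 c2 h k q (eta C1 C2 : R) w1 w2 : wf w ->
  w1 = rcons w (c1, h) -> w2 = rcons w1 (c2, k) ->
  (size w2 <= N)%N -> m = (top w).+1 -> (c1 <= m)%N -> (c2 <= m)%N -> 0 < eta ->
  lipschitz_with E w1 C1 -> lipschitz_with E w2 C2 ->
  (forall a b, 0 <= a <= eta -> 0 <= b <= eta ->
    `|translate c1 (a *: h) (translate c2 (b *: k) q) m - v0| < r) ->
  `|mixed_difference w c1 c2 h k q eta
    - eta ^+ 2 * (atom_weight w c1 * atom_weight w1 c2 * atom_value w2 q)| <=
  eta ^+ 2 * (atom_weight w c1 * atom_weight w1 c2 *
    (C1 * (t * enorm k) + C2 * (2 * (eta * (enorm h + enorm k))))).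
Proof.
move=> ww w1E w2E w2N mE c1m c2m eta0 lip1 lip2 qm.
have w1N : (size w1 < N)%N by move: w2N; rewrite w2E size_rcons.
have wN : (size w < N)%N by apply: ltnW; move: w1N; rewrite w1E size_rcons.
have e0 : (0 : R) <= 0 <= eta by apply/andP; split=> //; exact: ltW.
have ee : 0 <= eta <= eta by apply/andP; split=> //; exact: ltW.
have [t0 t1] := andP t01.
have topw : (c1 == m) ==> (top w < m)%N by rewrite mE ltnS leqnn implybT.
have c1m' : (c1 <= m <= (top w).+1)%N by rewrite c1m mE leqnn.
pose f b (a : R) := atom_value w (translate c1 (a *: h) (translate c2 (b *: k) q)).
pose df b (a : R) := atom_weight w c1 * atom_value w1 (translate c1 (a *: h) (translate c2 (b *: k) q)).
have fdf b a : 0 <= b <= eta -> 0 <= a <= eta -> is_derive a 1 (f b) (df b a).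
  move=> beta aeta; rewrite /df w1E.
  by apply: is_derive_atom_value_at => //; exact: qm.
have fdf2 a : 0 <= a <= eta -> is_derive a 1 (f eta - f 0) (df eta a - df 0 a).
  move=> aeta; have h1 := fdf eta a ee aeta; have h2 := fdf 0 a e0 aeta.
  exact: is_deriveB.
have [a aeta] := mean_value eta0 fdf2.
have [a0 ale] := andP aeta.
have -> : (f eta - f 0) eta - (f eta - f 0) 0 = mixed_difference w c1 c2 h k q eta.
  by rewrite /mixed_difference !fctE /f; ring.
move=> ->; rewrite /df; pose q' := translate c1 (a *: h) q.
have -> : translate c1 (a *: h) (translate c2 (0 *: k) q) = q' by rewrite scale0r translate0.
have -> : translate c1 (a *: h) (translate c2 (eta *: k) q) = translate c2 (eta *: k) q'.
  by rewrite translateC.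
have ww1 : wf w1 by rewrite w1E wf_rcons ww /= -mE.
have topw1 : (top w1 <= m)%N by rewrite w1E top_rcons mE geq_max leqnSn -mE.
have mw1 : (c2 <= m <= (top w1).+1)%N by rewrite c2m mE ltnS w1E top_rcons leq_maxl.
have inc : `|atom_value w1 (translate c2 (eta *: k) q') - atom_value w1 q'
    - eta * (atom_weight w1 c2 * atom_value w2 q')| <=
  eta * (atom_weight w1 c2 * (C1 * (t * enorm k) + C2 * (2 * (eta * enorm k)))).
  rewrite w2E; apply: atom_value_increment => //; first by rewrite -w2E.
  by move=> b beta; rewrite -translateC; apply: qm.
have stab : `|atom_value w2 q' - atom_value w2 q| <= C2 * (2 * (eta * enorm h)).
  apply: (le_trans (atom_value_translate _ _ _ lip2)); apply: ler_wpM2l; first by case: lip2.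
  by rewrite ler_pM2l// enormZ ger0_norm// ler_wpM2r// enorm_ge0.
move: inc stab; set x1 := atom_value w1 _; set x2 := atom_value w1 _.
set y1 := atom_value w2 q'; set y2 := atom_value w2 q => inc stab.
have W1 := atom_weight_ge0 w c1; have W2 := atom_weight_ge0 w1 c2.
set a1 := atom_weight w c1 in W1 *; set a2 := atom_weight w1 c2 in W2 inc *.
have -> : eta * (a1 * x1 - a1 * x2) - eta ^+ 2 * (a1 * a2 * y2) =
  (eta * a1) * (x1 - x2 - eta * (a2 * y1)) + (eta ^+ 2 * (a1 * a2)) * (y1 - y2) by ring.
apply: (le_trans (ler_normD _ _)); rewrite !normrM.
rewrite (gtr0_norm eta0) (ger0_norm W1) (ger0_norm W2).
have ea : 0 <= eta * a1 by rewrite mulr_ge0// ltW.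
have ea2 : 0 <= eta ^+ 2 * (a1 * a2) by apply: mulr_ge0; [exact: sqr_ge0 | exact: mulr_ge0].
apply: (le_trans (lerD (ler_wpM2l ea inc) (ler_wpM2l ea2 stab))).
by rewrite le_eqVlt; apply/orP; left; apply/eqP; ring.
Qed.

Lemma atom_weight_swap w c1 c2 h k : m = (top w).+1 -> (c1 <= m)%N -> (c2 <= m)%N ->
  atom_weight w c1 * atom_weight (rcons w (c1, h)) c2 =
  atom_weight w c2 * atom_weight (rcons w (c2, k)) c1.
Proof.
move=> mE c1m c2m; rewrite /atom_weight !top_rcons mE ltnSn !andbT /= !gtn_max ltnSn.
rewrite -mE !ltn_neqAle c1m c2m !andbT andTb andTb.
by case: (c1 == m); case: (c2 == m); rewrite /= ?mulr1 ?mul1r.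
Qed.

(** The symmetric second difference, divided by [eta ^+ 2] and by the common
    weight, approximates both derivatives with an error [O(t) + O(eta)], the
    constants depending on neither [r] nor [t]; then [eta] tends to 0. *)
Lemma atom_value_swap w c1 c2 h k q (C1 C2 C1' C2' : R) w12 w21 : wf w ->
  w12 = rcons (rcons w (c1, h)) (c2, k) -> w21 = rcons (rcons w (c2, k)) (c1, h) ->
  (size w12 <= N)%N -> m = (top w).+1 -> (c1 <= m)%N -> (c2 <= m)%N ->
  0 < t -> q m = v0 ->
  lipschitz_with E (rcons w (c1, h)) C1 -> lipschitz_with E w12 C2 ->
  lipschitz_with E (rcons w (c2, k)) C1' -> lipschitz_with E w21 C2' ->
  `|atom_value w12 q - atom_value w21 q| <= (C1 * enorm k + C1' * enorm h) * t.
Proof.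
move=> ww w12E w21E wN mE c1m c2m t0 qm lip1 lip2 lip1' lip2'.
apply/ler_addgt0Pr => e e0.
pose K := (C2 + C2') * (2 * (enorm h + enorm k)).
have [C20 _] := lip2; have [C20' _] := lip2'.
have K0 : 0 <= K by rewrite !mulr_ge0 ?addr_ge0 ?enorm_ge0.
have K1 : 0 < K + 1 by rewrite ltr_wpDl.
pose L := `|h| + `|k|; have L0 : 0 <= L by rewrite addr_ge0.
have L1 : 0 < L + 1 by rewrite ltr_wpDl.
(* the first bound makes the error in [eta] smaller than [e], the second keeps
   the atom in the cleared ball *)
pose eta := Num.min (e / (K + 1)) (r / (L + 1)).
have eta0 : 0 < eta by rewrite lt_min !divr_gt0.
have etae : eta * (K + 1) <= e by rewrite -ler_pdivlMr// ge_min lexx.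
have etar : eta * (L + 1) <= r by rewrite -ler_pdivlMr// ge_min lexx orbT.
have stay (a b : R) : 0 <= a <= eta -> 0 <= b <= eta ->
    `|translate c1 (a *: h) (translate c2 (b *: k) q) m - v0| < r.
  move=> /andP[a0 ae] /andP[b0 be].
  have -> : translate c1 (a *: h) (translate c2 (b *: k) q) m - v0 =
      (if m == c2 then b *: k else 0) + (if m == c1 then a *: h else 0).
    rewrite /translate qm; case: (m == c2); case: (m == c1); rewrite ?addr0 ?subrr//.
    - by rewrite [LHS]addrC -[v0 + _ + _]addrA addKr.
    - by rewrite [LHS]addrC addKr.
    - by rewrite add0r [LHS]addrC addKr.
  apply: (@le_lt_trans _ _ (eta * `|k| + eta * `|h|)).
    apply: (le_trans (ler_normD _ _)); apply: lerD.
      by case: ifP => _; rewrite ?normr0 ?mulr_ge0 ?(ltW eta0)//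
        normrZ ger0_norm// ler_wpM2r.
    by case: ifP => _; rewrite ?normr0 ?mulr_ge0 ?(ltW eta0)//
      normrZ ger0_norm// ler_wpM2r.
  apply: (lt_le_trans _ etar); rewrite -mulrDr ltr_pM2l// addrC.
  by rewrite ltrDl.
have := mixed_difference_approx ww erefl w12E wN mE c1m c2m eta0 lip1 lip2 stay.
have wN' : (size w21 <= N)%N by rewrite w21E !size_rcons; move: wN; rewrite w12E !size_rcons.
have stay' a b : 0 <= a <= eta -> 0 <= b <= eta ->
  `|translate c2 (a *: k) (translate c1 (b *: h) q) m - v0| < r.
  by move=> ha hb; rewrite translateC; apply: stay.
have := mixed_difference_approx ww erefl w21E wN' mE c2m c1m eta0 lip1' lip2' stay'.
have -> : mixed_difference w c2 c1 k h q eta = mixed_difference w c1 c2 h k q eta.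
  rewrite /mixed_difference !(translateC c2 c1); ring.
rewrite -(atom_weight_swap h k mE c1m c2m).
set W := atom_weight _ _ * _; set Dl := mixed_difference _ _ _ _ _ _ _.
set y := atom_value w12 q; set y' := atom_value w21 q => B2 B1.
have W0 : 0 < W.
  by rewrite /W mulr_gt0// /atom_weight; case: ifP => // _; rewrite ltr01.
have eW0 : 0 < eta ^+ 2 * W by rewrite mulr_gt0// exprn_gt0.
rewrite -(ler_pM2l eW0) -{1}(gtr0_norm eW0) -normrM.
have -> : eta ^+ 2 * W * (y - y') = (Dl - eta ^+ 2 * (W * y')) - (Dl - eta ^+ 2 * (W * y)) by ring.
apply: (le_trans (ler_normB _ _)); apply: (le_trans (lerD B2 B1)).
apply: (@le_trans _ _ (eta ^+ 2 * W * ((C1 * enorm k + C1' * enorm h) * t + eta * K))).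
  by rewrite /K le_eqVlt; apply/orP; left; apply/eqP; ring.
rewrite ler_pM2l// lerD2l; apply: le_trans etae.
by rewrite ler_pM2l// lerDl.
Qed.

End along_atom.
(** Passage from the perturbed laws to [mu], along [r = t] tending to 0. *)
Lemma eq_of_perturb s1 s2 x mu v (z : V) (K : R) : wf s1 -> wf s2 ->
  (0 < size s1 <= N)%N -> (0 < size s2 <= N)%N -> 0 <= K ->
  (forall (r t : R) (t01 : 0 <= t <= 1), 0 < r -> 0 < t ->
    `|E s1 x (perturb mu z r t01 z) v - E s2 x (perturb mu z r t01 z) v| <= K * t) ->
  E s1 x mu v = E s2 x mu v.
Proof.
move=> wf1 wf2 s1N s2N K0 H.
have [C1 [C10 L1]] := dc_lipschitz EP wf1 s1N.
have [C2 [C20 L2]] := dc_lipschitz EP wf2 s2N.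
have [M M0 HM] := W1_perturb_base mu z.
apply: (@eq_of_dist_le _ _ _ ((C1 + C2) * (d%:R * 2 + M) + K)) => t /andP[t0 t1].
have t01 : 0 <= t <= 1 by rewrite ltW.
have Wt := HM t t t01 (ltW t0).
have near s C (LC : forall (x y : V) mu nu (v v' : nat -> V) (B : R), (W1 mu nu <= B%:E)%E ->
    `|E s x mu v - E s y nu v'| <=
      C * (enorm (x - y) + \sum_(j < top s) enorm (v j.+1 - v' j.+1) + B)) :
  `|E s x mu v - E s x (perturb mu z t t01 z) v| <= C * ((d%:R * 2 + M) * t).
  apply: (le_trans (LC x x _ _ v v _ Wt)); rewrite subrr enorm0 add0r.
  rewrite big1 ?add0r => [|j _]; last by rewrite subrr enorm0.
  by rewrite le_eqVlt; apply/orP; left; apply/eqP; ring.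
have n1 := near s1 C1 L1; have n2 := near s2 C2 L2; have n3 := H t t t01 t0 t0.
set p1 := E s1 x mu v in n1 *; set p2 := E s2 x mu v in n2 *.
set q1 := E s1 x _ v in n1 n3; set q2 := E s2 x _ v in n2 n3.
have -> : p1 - p2 = (p1 - q1) + ((q1 - q2) - (p2 - q2)) by ring.
apply: (le_trans (ler_normD _ _)).
apply: (le_trans (lerD n1 (le_trans (ler_normB _ _) (lerD n3 n2)))).
by rewrite le_eqVlt; apply/orP; left; apply/eqP; ring.
Qed.

Lemma derivative_swap w c1 c2 h k x mu v : wf w -> ((size w).+2 <= N)%N ->
  (c1 <= (top w).+1)%N -> (c2 <= (top w).+1)%N ->
  E (rcons (rcons w (c1, h)) (c2, k)) x mu v =
  E (rcons (rcons w (c2, k)) (c1, h)) x mu v.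
Proof.
move=> ww wN c1m c2m.
have wf1 : wf (rcons w (c1, h)) by rewrite wf_rcons ww.
have wf2 : wf (rcons w (c2, k)) by rewrite wf_rcons ww.
have wf12 : wf (rcons (rcons w (c1, h)) (c2, k)).
  by rewrite wf_rcons wf1 (leq_trans c2m)// ltnS top_rcons leq_maxl.
have wf21 : wf (rcons (rcons w (c2, k)) (c1, h)).
  by rewrite wf_rcons wf2 (leq_trans c1m)// ltnS top_rcons leq_maxl.
have sz a b : (0 < size (rcons (rcons w a) b) <= N)%N by rewrite !size_rcons.
have sz1 a : (0 < size (rcons w a) <= N)%N by rewrite size_rcons /=; exact: ltnW.
have [C1 L1] := dc_lipschitz EP wf1 (sz1 _).
have [C1' L1'] := dc_lipschitz EP wf2 (sz1 _).
have [C2 L2] := dc_lipschitz EP wf12 (sz _ _).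
have [C2' L2'] := dc_lipschitz EP wf21 (sz _ _).
pose m := (top w).+1.
pose q := [eta v with 0%N |-> x] : nat -> V.
apply: (@eq_of_perturb _ _ x mu v (v m) (C1 * enorm k + C1' * enorm h)) => //.
  by apply: addr_ge0; apply: mulr_ge0; rewrite ?enorm_ge0//; [case: L1 | case: L1'].
move=> r t t01 r0 t0.
have m0 : (0 < m)%N by [].
have qm : q m = v m by [].
have [_ wN12] := andP (sz (c1, h) (c2, k)).
have := atom_value_swap mu t01 r0 m0 ww erefl erefl wN12 erefl c1m c2m t0 qm L1 L2 L1' L2'.
rewrite /atom_value qm !(@dc_ext _ EP _ x _ q v)//.
by move=> j /andP[j0 _]; rewrite /q /= gtn_eqF.
by move=> j /andP[j0 _]; rewrite /q /= gtn_eqF.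
Qed.

(** Derivatives of equal functions agree. For a Lions derivative, which is only
    determined almost everywhere by the function, this is read off at the atom
    of a perturbed law and extended by continuity. *)
Lemma derivative_rcons s1 s2 c h x mu v : wf s1 -> wf s2 ->
  top s1 = top s2 -> (size s1 < N)%N -> (size s2 < N)%N ->
  (forall x mu v, E s1 x mu v = E s2 x mu v) -> (c <= (top s1).+1)%N ->
  E (rcons s1 (c, h)) x mu v = E (rcons s2 (c, h)) x mu v.
Proof.
move=> wf1 wf2 tops s1N s2N E12.
have uniq (f g : R -> R) l l' : f = g -> is_derive (0 : R) 1 f l ->
    is_derive (0 : R) 1 g l' -> l = l'.
  by move=> -> [_ <-] [_ <-].
rewrite leq_eqVlt => /predU1P[cE|]; last first.
  rewrite ltnS => ctop; have [->|c0] := eqVneq c 0%N.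
    apply: (uniq _ _ _ _ _ (dc_x EP x mu v h wf1 s1N) (dc_x EP x mu v h wf2 s2N)).
    exact/funext.
  have c1 : (1 <= c <= top s1)%N by rewrite lt0n c0.
  have c2 : (1 <= c <= top s2)%N by rewrite -tops.
  apply: (uniq _ _ _ _ _ (dc_v EP x mu v h wf1 s1N c1) (dc_v EP x mu v h wf2 s2N c2)).
  exact/funext.
apply: (@eq_of_perturb _ _ x mu v (v c) 0) => //.
- by rewrite wf_rcons wf1 cE /=.
- by rewrite wf_rcons wf2 cE tops /=.
- by rewrite size_rcons.
- by rewrite size_rcons.
move=> r t t01 r0 t0; rewrite mul0r normr_le0 subr_eq0; apply/eqP.
have vr : `|v c - v c| < r by rewrite subrr normr0.
have D1 := dc_mu EP x mu v h t01 wf1 s1N r0 vr.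
have D2 := dc_mu EP x mu v h t01 wf2 s2N r0 vr.
rewrite -tops -cE in D2; rewrite -cE in D1.
have vE : ([eta v with c |-> v c] : nat -> V) = v.
  by apply/funext => n /=; case: eqP => // ->.
rewrite vE in D1 D2.
apply: (mulfI (lt0r_neq0 t0)); apply: uniq D1 D2.
exact/funext.
Qed.

Theorem derivative_perm s1 s2 : wf s1 -> wf s2 -> perm_eq s1 s2 -> (size s1 <= N)%N ->
  forall x mu v, E s1 x mu v = E s2 x mu v.
Proof.
move=> wf1 wf2 s12.
pose rel s s' := size s = size s' /\
  ((size s <= N)%N -> forall x mu v, E s x mu v = E s' x mu v).
suff [_] : rel s1 s2 by [].
apply: (@perm_rel _ fst rel) => // {wf1 wf2 s12 s1 s2}.
- move=> s1 s2 s3 [z12 e12] [z23 e23]; split; first by rewrite z12.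
  by move=> sN x mu v; rewrite e12// e23// -z12.
- move=> w [c1 h] [c2 k] ww c1w c2w; rewrite /rel !size_rcons; split=> // wN x mu v.
  exact: derivative_swap.
- move=> s1 s2 [c h] wf1 wf2 s12 [z12 e12]; rewrite wf_rcons => /andP[_ cs].
  rewrite /rel !size_rcons z12; split=> // sN x mu v.
  apply: derivative_rcons => //; first exact/max_label_perm/perm_map.
  - by rewrite z12.
  - by apply: e12; rewrite z12 ltnW.
Qed.

End calculus.

(** * Tensors *)

Section token_derivative.
Context {R : realType} {disp : measure_display} {Om : measurableType disp}.
Variables (P : probability Om R) (d e N : nat).
Variables (f : 'rV[R]_d -> P2 R d -> 'rV[R]_e) (D : deriv_family R d e).
Notation V := 'rV[R]_d.
Notation token := (nat * V)%type.
Implicit Types (s : seq token).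

Definition token_vec s (j : nat) : V := (nth (0%N, 0) s j).2.

(** For the empty word this is [f] itself, so that the first derivative is no
    special case. The other words are words of pairs (label, vector). *)
Definition token_deriv s (x : V) (mu : P2 R d) (v : nat -> V) : 'rV[R]_e :=
  if s is [::] then f x mu else
  tens (fun j : 'I_(size s) => token_vec s j)
    *m @D (size s) [tuple of map fst (in_tuple s)] x mu (vars (map fst s) v).

Lemma token_derivE i (a : i.-tuple nat) s x mu v : (0 < i)%N -> map fst s = a ->
  token_deriv s x mu v =
  tens (fun j : 'I_i => token_vec s j) *m @D i a x mu (vars a v).
Proof.
move=> i0 sa; have si : size s = i by rewrite -(size_map fst) sa size_tuple.
subst i; have -> : a = [tuple of map fst (in_tuple s)] by apply: val_inj.
by rewrite /token_deriv; case: s i0 {a sa}.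
Qed.

(** The last tensor slot holds the direction of the last derivative. *)
Lemma token_deriv_rcons i (a : i.-tuple nat) s c h x mu v : map fst s = a ->
  token_deriv (rcons s (c, h)) x mu v =
  tens (fun j : 'I_i => token_vec s j)
    *m plug_last (@D i.+1 [tuple of rcons a c] x mu (vars (rcons a c) v)) h.
Proof.
move=> sa; have si : size s = i by rewrite -(size_map fst) sa size_tuple.
rewrite (@token_derivE _ [tuple of rcons a c])//; last by rewrite map_rcons sa.
rewrite -tens_plug_last /token_vec nth_rcons si ltnn eqxx; congr (tens _ *m _).
by apply/funext => j; rewrite /comp lift_max nth_rcons si ltn_ord.
Qed.

Lemma token_deriv1 c h x mu v : token_deriv [:: (c, h)] x mu v =
  tens (fun _ : 'I_1 => h) *m @D 1%N [tuple c] x mu (vars [tuple c] v).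
Proof.
rewrite (@token_derivE _ [tuple c])//; congr (tens _ *m _).
by apply/funext => j; rewrite /token_vec ord1.
Qed.

Hypothesis DP : Cb_derivatives P N f D.
Hypothesis d0 : (0 < d)%N.

Lemma token_derivative_calculus (q : 'I_e) :
  derivative_calculus N (fun s x mu v => token_deriv s x mu v 0 q).
Proof.
have [D0 Dbl Dstep] := DP.
have top0 : max_label [::] = 0%N by rewrite /max_label big_nil.
have valid s : wf_word (map fst s) -> shuffle0_seq (size s) (map fst s).
  by move=> ws; rewrite -(size_map fst) wf_shuffle0_seq.
have derivE s (a := [tuple of map fst (in_tuple s)]) x mu v : (0 < size s)%N ->
    token_deriv s x mu v =
    tens (fun j : 'I_(size s) => token_vec s j) *m @D (size s) a x mu (vars a v).
  by move=> s0; exact: token_derivE.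
split.
- move=> s x mu v h ws sN; have [s0|s0] := posnP (size s).
    rewrite (size0nil s0).
    have [dF dE _] := D0 (leq_ltn_trans (leq0n _) sN) x mu v.
    have -> : token_deriv (rcons [::] (0%N, h)) x mu v = 'd (f^~ mu) x h.
      by rewrite dE -token_deriv1.
    exact: (@is_derive_line _ _ _ _ (f^~ mu)).
  have sN0 : (0 < size s < N)%N by rewrite s0.
  pose a := [tuple of map fst (in_tuple s)].
  have [[dF dE] _ _] := Dstep _ a sN0 (valid s ws) x mu v.
  rewrite (_ : (fun b => _) = fun b : R => (tens (fun j : 'I_(size s) => token_vec s j)
      *m @D (size s) a (x + b *: h) mu (vars a v)) 0 q); last first.
    by apply/funext => b; rewrite derivE.
  rewrite (@token_deriv_rcons _ a)// -dE.
  by apply: is_derive_mulmx => r; exact: is_derive_line.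
- move=> s x mu v p h ws sN ptop; have [s0|s0] := posnP (size s).
    by move: ptop; rewrite (size0nil s0) top0; case: p.
  have sN0 : (0 < size s < N)%N by rewrite s0.
  pose a := [tuple of map fst (in_tuple s)].
  have [_ _ /(_ p ptop)[dF dE]] := Dstep _ a sN0 (valid s ws) x mu v.
  rewrite (_ : (fun b => _) = fun b : R => (tens (fun j : 'I_(size s) => token_vec s j)
      *m @D (size s) a x mu (vars a [eta v with p |-> v p + b *: h])) 0 q); last first.
    by apply/funext => b; rewrite derivE.
  rewrite (@token_deriv_rcons _ a)// -dE.
  apply: is_derive_mulmx => r.
  exact: (@is_derive_line _ _ _ _
    (fun y => @D (size s) a x mu (vars a [eta v with p |-> y]))).
- move=> s x mu v h v0 r t t01 z ws sN r0 zr; have [s0|s0] := posnP (size s).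
    rewrite (size0nil s0) top0.
    have [_ _ L] := D0 (leq_ltn_trans (leq0n _) sN) x (perturb mu v0 r t01 z) v.
    rewrite -[rcons _ _]/[:: (1%N, h)] token_deriv1.
    exact: (lions_derivative_move_atom h 0 q d0 r0 zr L).
  have sN0 : (0 < size s < N)%N by rewrite s0.
  pose a := [tuple of map fst (in_tuple s)].
  have [_ L _] := Dstep _ a sN0 (valid s ws) x (perturb mu v0 r t01 z) v.
  rewrite (_ : (fun b => _) = fun b : R => (tens (fun j : 'I_(size s) => token_vec s j)
      *m @D (size s) a x (perturb mu v0 r t01 (z + b *: h)) (vars a v)) 0 q); last first.
    by apply/funext => b; rewrite derivE.
  rewrite (@token_deriv_rcons _ a)//.
  have scaleE n (A : 'rV[R]_n) (M : 'M[R]_(n, e)) : t * (A *m M) 0 q = (A *m (t *: M)) 0 q.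
    by rewrite -scalemxAr [in RHS]mxE.
  rewrite scaleE; apply: is_derive_mulmx => i; rewrite mxE.
  exact: (lions_derivative_move_atom h i q d0 r0 zr L).
- move=> s ws /[dup] sN /andP[s0 _].
  pose a := [tuple of map fst (in_tuple s)].
  have [_ [C HC]] := Dbl _ a sN (valid s ws).
  pose A := tens (fun j : 'I_(size s) => token_vec s j).
  pose S := \sum_i `|A 0 i|; have S0 : 0 <= S by apply: sumr_ge0.
  exists (S * `|C|); split; first exact: mulr_ge0.
  move=> x y mu nu v v' B WB; rewrite !derivE//.
  set Q := enorm (x - y) + \sum_(j < max_label (map fst s)) enorm (v j.+1 - v' j.+1).
  have Q0 : 0 <= Q by rewrite addr_ge0 ?sumr_ge0// => *; rewrite enorm_ge0.
  have W0 := W1_ge0 mu nu.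
  have HD : `|@D (size s) a x mu (vars a v) - @D (size s) a y nu (vars a v')| <= `|C| * (Q + B).
    have /le_trans {}HC : (_ <= C%:E * (Q%:E + W1 mu nu))%E := HC x y mu nu (vars a v) (vars a v').
    rewrite -lee_fin; apply: HC; rewrite EFinM; apply: (@le_trans _ _ (`|C|%:E * (Q%:E + W1 mu nu))%E).
      by apply: lee_wpmul2r; rewrite ?lee_fin ?ler_norm// adde_ge0.
    by apply: lee_wpmul2l; rewrite ?lee_fin// [leRHS]EFinD; exact: leeD2l.
  have -> : (A *m @D (size s) a x mu (vars a v)) 0 q - (A *m @D (size s) a y nu (vars a v')) 0 q =
    (A *m (@D (size s) a x mu (vars a v) - @D (size s) a y nu (vars a v'))) 0 q.
    by rewrite mulmxBr [in RHS]mxE [X in _ = _ + X]mxE.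
  rewrite mxE; apply: (le_trans (ler_norm_sum _ _ _)).
  rewrite -mulrA mulr_suml; apply: ler_sum => i _; rewrite normrM.
  by apply: ler_wpM2l => //; apply: le_trans HD; exact: norm_entry_le.
- move=> s x mu v v' vv'; have [s0|s0] := posnP (size s).
    by rewrite (size0nil s0).
  rewrite !derivE//; congr ((_ *m @D _ _ _ _ _) _ _); apply/funext => j.
  by rewrite /vars vv'//= ltn_ord.
Qed.

End token_derivative.

(** * The theorem *)

Theorem theorem2p18 (R : realType) (disp : measure_display)
    (Om : measurableType disp) (P : probability Om R) (d e : nat)
    (k n : nat) (hkn : (2 <= k + n)%N) (a b : (k + n).-tuple nat)
    (ha : shuffle_seq k n a) (hb : shuffle_seq k n b)
    (hab : forall i : nat, (1 <= i <= max_label a)%N -> count_mem i a = count_mem i b)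
    (f : 'rV[R]_d -> P2 R d -> 'rV[R]_e) (D : deriv_family R d e)
    (hf : Cb_derivatives P (k + n) f D)
    (u : 'I_(k + n) -> 'rV[R]_d) (sigma : 'S_(k + n))
    (hsigma : forall i : 'I_(k + n), tnth a (sigma i) = tnth b i)
    (x : 'rV[R]_d) (mu : P2 R d) (v : nat -> 'rV[R]_d) :
  tens u *m D (k + n)%N a x mu (vars a v) =
  tens (fun i => u (sigma i)) *m D (k + n)%N b x mu (vars b v).
Proof.
have N0 : (0 < k + n)%N by exact: ltnW.
have [d0|d0] := posnP d.
  (* in dimension 0 there is no tensor of positive order *)
  subst d; apply/rowP => q; rewrite !mxE !big1// => r _;
  by have := tindex r (Ordinal N0); case.
pose tokens (c : (k + n).-tuple nat) w : seq (nat * 'rV[R]_d) :=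
  [seq (tnth c i, w i) | i <- enum 'I_(k + n)].
have labels c w : map fst (tokens c w) = c.
  by rewrite -map_comp; exact: map_tnth_enum.
have size_tokens c w : size (tokens c w) = (k + n)%N.
  by rewrite size_map size_enum_ord.
have derivE c w : tens w *m D _ c x mu (vars c v) =
    token_deriv f D (tokens c w) x mu v.
  rewrite (token_derivE _ _ x mu v N0 (labels c w)); congr (tens _ *m _).
  apply/funext => i; rewrite /token_vec (nth_map i) ?size_enum_ord//.
  by rewrite nth_ord_enum.
have perm_tokens : perm_eq (tokens a u) (tokens b (u \o sigma)).
  have -> : tokens b (u \o sigma) =
      map (fun i => (tnth a i, u i)) (map sigma (enum 'I_(k + n))).
    by rewrite -map_comp; apply: eq_map => i /=; rewrite hsigma.
  apply: perm_map; apply: uniq_perm.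
  - exact: enum_uniq.
  - by rewrite map_inj_uniq ?enum_uniq//; exact: perm_inj.
  - move=> i; rewrite mem_enum; apply/esym/mapP.
    by exists ((sigma^-1)%g i); rewrite ?mem_enum ?permKV.
rewrite !derivE; apply/rowP => q.
apply: (derivative_perm (token_derivative_calculus hf d0 q) _ _ perm_tokens).
- by rewrite labels; exact: shuffle_seq_wf ha.
- by rewrite labels; exact: shuffle_seq_wf hb.
- by rewrite size_tokens.
Qed.
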